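(* Let $A,E\in\mathbb{R}^{n\times m}$, $\widetilde A=A+E$, $1\le r<\min\{n,m\}$, and let $U_1\Sigma_1$ and $\widetilde U_1\widetilde\Sigma_1$ be the rank-$r$ PCA embeddings of $A$ and $\widetilde A$. Then \[\min_{Q\in\mathbb{O}_r}\|U_1\Sigma_1-\widetilde U_1\widetilde\Sigma_1Q\|\le 3\|E\|+3\sigma_{r+1}\min\Big\{\frac{2\|E\|}{\sigma_r-\sigma_{r+1}},1\Big\},\] \[\min_{Q\in\mathbb{O}_r}\|U_1\Sigma_1-\widetilde U_1\widetilde\Sigma_1Q\|_F\le\Big(2\|E_r\|_F^2+3\Big(\|E_r\|_F+\|(\Sigma_2)_r\|_F\,\mu\Big)^2\Big)^{1/2}+\|E_r\|_F+\|(\Sigma_2)_r\|_F\,\mu,\] where $\mu=\min\{\frac{2\|E\|}{\sigma_r-\sigma_{r+1}},1\}$ and the minima are interpreted as $1$ when $\sigma_r=\sigma_{r+1}$.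
   Context: $A=U\Sigma V^T$ and $\widetilde A=\widetilde U\widetilde\Sigma\widetilde V^T$ are SVDs with singular values $\sigma_1\ge\sigma_2\ge\dots$ of $A$ in nonincreasing order; $U_1,\widetilde U_1\in\mathbb{R}^{n\times r}$ hold the leading $r$ left singular vectors, and $\Sigma_1,\widetilde\Sigma_1$ are the $r\times r$ diagonal matrices of the $r$ largest singular values of $A$, $\widetilde A$. $\mathbb{O}_r$ is the set of $r\times r$ orthogonal matrices. For a matrix $M$, $M_r$ denotes its rank-$r$ hard thresholding (all but the $r$ largest singular values set to $0$). $\Sigma_2$ is the (rectangular) diagonal matrix with diagonal $\sigma_{r+1},\dots,\sigma_{\min\{n,m\}}$, so $\|(\Sigma_2)_r\|_F^2=\sum_{k=1}^r\sigma_{r+k}^2$ (with $\sigma_i=0$ for $i>\min\{n,m\}$). $\|\cdot\|$ is the spectral norm and $\|\cdot\|_F$ the Frobenius norm. *)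

(* Defs.v *)
From HB Require Import structures.
From mathcomp Require Import all_boot all_order all_algebra.
From mathcomp Require Import boolp classical_sets reals.
Set Implicit Arguments. Unset Strict Implicit. Unset Printing Implicit Defensive.
Import Order.TTheory GRing.Theory Num.Theory.
Local Open Scope ring_scope.
Local Open Scope classical_set_scope.

Section SVDDefs.
Variable R : realType.

Definition frob n m (A : 'M[R]_(n, m)) : R :=
  Num.sqrt (\sum_(i < n) \sum_(j < m) A i j ^+ 2).

Definition specnorm n m (A : 'M[R]_(n, m)) : R :=
  sup [set frob (A *m x) | x in [set x : 'cV[R]_m | frob x <= 1]].

Definition orthogonal_mx r (Q : 'M[R]_r) : Prop := Q^T *m Q = 1%:M.

Definition diag_rect n m (s : nat -> R) : 'M[R]_(n, m) :=
  \matrix_(i < n, j < m) (if nat_of_ord i == nat_of_ord j then s i else 0).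

(* (U, s, V) is an SVD of A: U, V orthogonal, s = singular values
   sigma_1 >= sigma_2 >= ... >= 0 (stored 0-indexed: s k = sigma_(k+1)),
   with s k = 0 for k >= min(n,m), and A = U Sigma V^T. *)
Definition is_svd n m (A : 'M[R]_(n, m)) (U : 'M[R]_n) (s : nat -> R)
    (V : 'M[R]_m) : Prop :=
  [/\ orthogonal_mx U, orthogonal_mx V,
      (forall i j, (i <= j)%N -> s j <= s i) /\ (forall i, 0 <= s i),
      (forall i, (minn n m <= i)%N -> s i = 0) &
      A = U *m diag_rect n m s *m V^T].

Definition lead_cols n r (U : 'M[R]_n) : 'M[R]_(n, r) :=
  \matrix_(i < n, j < r)
    (if insub (nat_of_ord j) : option 'I_n is Some k then U i k else 0).

Definition lead_sigma r (s : nat -> R) : 'M[R]_r := diag_rect r r s.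

(* Rank-r hard thresholding M_r of M, computed from an SVD (U, s, V) of M:
   all but the r largest singular values set to 0. *)
Definition hard_thr n m r (U : 'M[R]_n) (s : nat -> R) (V : 'M[R]_m)
    : 'M[R]_(n, m) :=
  U *m diag_rect n m (fun k => if (k < r)%N then s k else 0) *m V^T.

(* ||(Sigma_2)_r||_F = sqrt(sum_{k=1}^r sigma_{r+k}^2). *)
Definition tail_frob r (s : nat -> R) : R :=
  Num.sqrt (\sum_(k < r) s (r + k)%N ^+ 2).

(* mu = min{2||E|| / (sigma_r - sigma_{r+1}), 1}, and 1 if sigma_r = sigma_{r+1}.
   With 0-indexed s: sigma_r = s (r-1), sigma_{r+1} = s r. *)
Definition mu_coef (normE sr sr1 : R) : R :=
  if sr == sr1 then 1 else Num.min (2 * normE / (sr - sr1)) 1.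

End SVDDefs.

(* Main.v *)
(** Write [B = A + E] and let [X = A V1], [X' = B V1'] be the two embeddings.
    For a [frame] [F] (a matrix with orthonormal columns), [coproj F] projects
    onto the orthogonal complement of its range.  Weyl's and Wedin's
    inequalities give sines at most [mu] between the leading singular
    subspaces.  By a min-max argument the
    singular values number [r+1, ..., 2r] of [B] have Frobenius norm at most
    that of the same singular values of [A] plus [||E_r||_F].

    Frobenius norm: let [Q] come from the polar factor of [U1'^T X], so that
    [U1'^T X Q = H] is positive semidefinite.  Then [||X' - X Q||^2] splits into
    [||S1' - H||^2] and [||coproj U1' X||^2].  The first is at most twice
    [||U1'^T B - U1'^T A V1 V1^T||^2], by [|| |M| - |N| || <= sqrt 2 ||M - N||].

    Spectral norm: let [Q] come from the polar factor of [V1'^T V1], so that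
    [V1'^T V1 Q = H] is positive semidefinite with
    [1 - H = (1 - H^2) (1 + H)^-1] and [1 - H^2 = V1'^T (coproj V1) V1'].
    Then expand [X' - X Q = U1' S1' (1 - H) - B (coproj V1') V1 Q + E V1 Q].

    Polar factors come from the singular value decomposition of a square
    matrix, obtained by maximizing a weighted trace over pairs of orthogonal
    matrices. *)
Require Import Defs.
From HB Require Import structures.
From mathcomp Require Import all_boot all_order all_algebra.
From mathcomp Require Import boolp classical_sets reals.
From mathcomp Require Import topology normedtype derive.
From mathcomp Require Import ring lra zify.
Import Order.TTheory GRing.Theory Num.Theory.
Import numFieldNormedType.Exports.
Local Open Scope ring_scope.
Local Open Scope classical_set_scope.
Set Implicit Arguments. Unset Strict Implicit. Unset Printing Implicit Defensive.

(** * Singular value decomposition of a square matrix *)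

Lemma continuous_entries_mulmx (R : realType) (T : topologicalType) m n p
    (f : T -> 'M[R]_(m, n)) (g : T -> 'M[R]_(n, p)) :
  (forall i j, continuous (fun x => f x i j : R)) ->
  (forall i j, continuous (fun x => g x i j : R)) ->
  forall i j, continuous (fun x => (f x *m g x) i j : R).
Proof.
move=> cf cg i j x.
have -> : (fun y => (f y *m g y) i j : R) = (fun y => \sum_k f y i k * g y k j).
  by apply/funext => y; rewrite mxE.
rewrite /continuous_at /=; apply: cvg_big => [|k _]; first exact: add_continuous.
by apply: cvgM; [exact: cf|exact: cg].
Qed.

Lemma orthogonal_mx_tr (R : realType) r (Q : 'M[R]_r) :
  orthogonal_mx Q -> orthogonal_mx Q^T.
Proof. by rewrite /orthogonal_mx trmxK => /mulmx1C. Qed.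

Lemma orthogonal_mxM (R : realType) r (P Q : 'M[R]_r) :
  orthogonal_mx P -> orthogonal_mx Q -> orthogonal_mx (P *m Q).
Proof.
by rewrite /orthogonal_mx => hP hQ; rewrite trmx_mul mulmxA -(mulmxA Q^T) hP mulmx1.
Qed.

Lemma orthogonal_mx_entry_le1 (R : realType) r (Q : 'M[R]_r) i j :
  orthogonal_mx Q -> `|Q i j| <= 1.
Proof.
move=> /matrixP /(_ j j); rewrite !mxE eqxx => h.
rewrite -(@expr_le1 _ 2) // -[leRHS]/(true%:R) -h real_normK ?num_real //.
rewrite (bigD1 i) //= mxE expr2 lerDl sumr_ge0 // => k _.
by rewrite mxE -expr2 sqr_ge0.
Qed.

(** Compactness of the set of pairs of orthogonal matrices. Continuity of [f] is tested along
    entrywise continuous families, so no topology on pairs of matrices enters; the proof packs a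
    pair into one row vector, where closed bounded sets are compact. *)
Lemma orthogonal_pair_maximum (R : realType) r (f : 'M[R]_r -> 'M[R]_r -> R) :
  (forall (T : topologicalType) (P Q : T -> 'M[R]_r),
    (forall i j, continuous (fun x => P x i j : R)) ->
    (forall i j, continuous (fun x => Q x i j : R)) ->
    continuous (fun x => f (P x) (Q x))) ->
  exists P Q, [/\ orthogonal_mx P, orthogonal_mx Q &
    forall P' Q', orthogonal_mx P' -> orthogonal_mx Q' -> f P' Q' <= f P Q].
Proof.
move=> cf.
pose P (v : 'rV[R]_(r * r + r * r)) : 'M[R]_r := vec_mx (lsubmx v).
pose Q (v : 'rV[R]_(r * r + r * r)) : 'M[R]_r := vec_mx (rsubmx v).
have cP i j : continuous (fun v => P v i j : R).
  move=> v; have -> : (fun v => P v i j : R) =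
      (fun v : 'rV[R]_(r * r + r * r) => v 0 (lshift _ (mxvec_index i j))).
    by apply/funext => w; rewrite !mxE.
  exact: coord_continuous.
have cQ i j : continuous (fun v => Q v i j : R).
  move=> v; have -> : (fun v => Q v i j : R) =
      (fun v : 'rV[R]_(r * r + r * r) => v 0 (rshift _ (mxvec_index i j))).
    by apply/funext => w; rewrite !mxE.
  exact: coord_continuous.
pose S := [set v | orthogonal_mx (P v) /\ orthogonal_mx (Q v)].
have clorth (F : 'rV[R]_(r * r + r * r) -> 'M[R]_r) :
    (forall i j, continuous (fun v => F v i j : R)) ->
    closed [set v | orthogonal_mx (F v)].
  move=> cF; have -> : [set v | orthogonal_mx (F v)] =
      \bigcap_(ij in [set: 'I_r * 'I_r]) ((fun v => ((F v)^T *m F v) ij.1 ij.2) @^-1`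
        [set (1%:M : 'M[R]_r) ij.1 ij.2]).
    apply/seteqP; split => v /=.
      by move=> h [i j] _ /=; rewrite h.
    by move=> h; apply/matrixP => i j; exact: (h (i, j)).
  have cFT i j : continuous (fun v => (F v)^T i j : R).
    have -> : (fun v => (F v)^T i j : R) = (fun v => F v j i).
      by apply/funext => v; rewrite mxE.
    exact: cF.
  apply: closed_bigI => -[i j] _; apply: preimage_closed.
    by move=> v _; exact: (continuous_entries_mulmx cFT cF).
  exact: closed_eq.
have clS : closed S by apply: closedI; [apply: (clorth P)|apply: (clorth Q)].
(* The norm on row vectors is the maximum norm, and entries of orthogonal matrices are at most 1 in
   absolute value. *)
have bS : bounded_set S.
  exists 1; split=> // M M1 v [hP hQ] /=.
  rewrite [leLHS]/Num.norm /= mx_normrE; apply/bigmax_leP; split => [|[i j] _ /=].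
    by apply: ltW; apply: lt_trans M1.
  apply: le_trans (ltW M1); rewrite (ord1 i).
  case: (split_ordP j) => k ->; case/mxvec_indexP: k => a b.
    by have := orthogonal_mx_entry_le1 a b hP; rewrite !mxE.
  by have := orthogonal_mx_entry_le1 a b hQ; rewrite !mxE.
have PQK A B : P (row_mx (mxvec A) (mxvec B)) = A /\ Q (row_mx (mxvec A) (mxvec B)) = B.
  by rewrite /P /Q row_mxKl row_mxKr !mxvecK.
have memS A B : orthogonal_mx A -> orthogonal_mx B -> S (row_mx (mxvec A) (mxvec B)).
  by move=> hA hB; rewrite /S /=; have [-> ->] := PQK A B.
have o1 : orthogonal_mx (1%:M : 'M[R]_r) by rewrite /orthogonal_mx trmx1 mulmx1.
have [|||v vS vmax] := @compact_EVT_max _ R (fun v => f (P v) (Q v)) S.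
- by exists (row_mx (mxvec 1%:M) (mxvec 1%:M)); exact: memS.
- exact: bounded_closed_compact.
- by apply: continuous_subspaceT; exact: cf.
move: vS => /set_mem [hP hQ]; exists (P v), (Q v); split=> // A B hA hB.
have := vmax (row_mx (mxvec A) (mxvec B)) (mem_set (memS _ _ hA hB)).
by have [-> ->] := PQK A B.
Qed.

(** A Householder reflection: it is symmetric, and it squares to 1 because [t^2 (v^T v) = 2 t]. *)
Lemma orthogonal_reflection (R : realType) r (v : 'cV[R]_r) (t : R) :
  t * (v^T *m v) 0 0 = 2 -> orthogonal_mx (1%:M - t *: (v *m v^T)).
Proof.
move=> h; rewrite /orthogonal_mx.
have -> : (1%:M - t *: (v *m v^T))^T = 1%:M - t *: (v *m v^T).
  by rewrite linearB /= linearZ /= trmx_mul trmxK trmx1.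
rewrite mulmxBl mul1mx mulmxBr mulmx1 -scalemxAl -scalemxAr scalerA.
rewrite mulmxA -(mulmxA v) [v^T *m v]mx11_scalar mul_mx_scalar -scalemxAl.
rewrite scalerA -mulrA h -addrA -opprD -scalerBl -scalerDl.
by rewrite (_ : t + _ = 0) ?scale0r ?subr0 //; ring.
Qed.

Lemma mulmx_delta_entry (R : realType) r (M : 'M[R]_r) i j :
  ((delta_mx i 0 : 'cV[R]_r)^T *m M *m (delta_mx j 0 : 'cV[R]_r)) 0 0 = M i j.
Proof. by rewrite trmx_delta -rowE -colE !mxE. Qed.

Lemma mxtrace_outer (R : realType) r (M : 'M[R]_r) (u v : 'cV[R]_r) :
  \tr (M *m (u *m v^T)) = (v^T *m M *m u) 0 0.
Proof. by rewrite mulmxA mxtrace_mulC mulmxA trace_mx11. Qed.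

(** Optimality is tested on explicit matrices only: one reflection gives the sign of a diagonal
    entry, a product of two gives symmetry. *)
Lemma trace_maximal_sym (R : realType) r (M : 'M[R]_r) :
  (forall Q, orthogonal_mx Q -> \tr (M *m Q) <= \tr M) ->
  M^T = M /\ forall i, 0 <= M i i.
Proof.
move=> Mmax.
have mx_addE m n (A B : 'M[R]_(m, n)) i j : (A + B) i j = A i j + B i j by rewrite mxE.
have mxtraceB n (A B : 'M[R]_n) : \tr (A - B) = \tr A - \tr B by rewrite linearB.
have mx_scaleE m n c (A : 'M[R]_(m, n)) i j : (c *: A) i j = c * A i j by rewrite mxE.
have dd i j : ((delta_mx i 0 : 'cV[R]_r)^T *m (delta_mx j 0 : 'cV[R]_r)) 0 0
    = (i == j)%:R.
  by rewrite -[_^T]mulmx1 mulmx_delta_entry mxE.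
have oi i : orthogonal_mx (1%:M - 2 *: (delta_mx i 0 *m (delta_mx i 0 : 'cV[R]_r)^T)).
  by apply: orthogonal_reflection; rewrite dd eqxx mulr1.
have diag i : 0 <= M i i.
  have := Mmax _ (oi i); rewrite mulmxBr mulmx1 linearB /= -scalemxAr linearZ /=.
  by rewrite mxtrace_outer mulmx_delta_entry => h; lra.
split=> //; apply/matrixP => i j; rewrite mxE.
have [-> //|nij] := eqVneq i j.
(* The product of the reflections along [e_i] and [e_i + t e_j] is a plane
   rotation; comparing traces gives [t (M j i - M i j) <= t^2 (M i i + M j j)]. *)
have rot (t : R) : t * (M j i - M i j) <= t ^+ 2 * (M i i + M j j).
  pose v : 'cV[R]_r := delta_mx i 0 + t *: delta_mx j 0.
  have t0 : 0 < 1 + t ^+ 2 by apply: ltr_wpDr => //; exact: sqr_ge0.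
  have vT : v^T = (delta_mx i 0)^T + t *: (delta_mx j 0)^T.
    by rewrite /v linearD /= linearZ.
  have bil (N : 'M[R]_r) : (v^T *m N *m v) 0 0 =
      N i i + t * N i j + t * N j i + t ^+ 2 * N j j.
    rewrite vT /v !mulmxDl !mulmxDr -!scalemxAl -!scalemxAr.
    rewrite !(mx_addE, mx_scaleE) !mulmx_delta_entry; ring.
  have vv : (v^T *m v) 0 0 = 1 + t ^+ 2.
    rewrite -[v^T]mulmx1 bil !mxE !eqxx (negPf nij) eq_sym (negPf nij).
    by rewrite !mulr0 !addr0 mulr1.
  have uv : ((delta_mx i 0 : 'cV[R]_r)^T *m v) 0 0 = 1.
    by rewrite /v mulmxDr -scalemxAr mx_addE mx_scaleE !dd eqxx (negPf nij) mulr0 addr0.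
  have vMu : (v^T *m M *m (delta_mx i 0 : 'cV_r)) 0 0 = M i i + t * M j i.
    by rewrite vT !mulmxDl -!scalemxAl mx_addE mx_scaleE !mulmx_delta_entry.
  have ov : orthogonal_mx (1%:M - (2 / (1 + t ^+ 2)) *: (v *m v^T)).
    by apply: orthogonal_reflection; rewrite vv divfK // gt_eqF.
  have := Mmax _ (orthogonal_mxM (oi i) ov).
  set s := 2 / _; set u := delta_mx i 0 : 'cV[R]_r.
  have -> : (1%:M - 2 *: (u *m u^T)) *m (1%:M - s *: (v *m v^T)) =
      1%:M - s *: (v *m v^T) - (2 *: (u *m u^T) - (2 * s) *: (u *m v^T)).
    rewrite mulmxBl mul1mx mulmxBr mulmx1; congr (_ - (_ - _)).
    rewrite -scalemxAl -scalemxAr scalerA -mulmxA (mulmxA _ v).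
    by rewrite [_^T *m v]mx11_scalar uv mul1mx.
  rewrite !mulmxBr mulmx1 -!scalemxAr !mxtraceB !mxtraceZ !mxtrace_outer.
  rewrite mulmx_delta_entry bil vMu => h.
  have s0 : 0 < s by rewrite divr_gt0.
  have hs : s * (1 + t ^+ 2) = 2 by rewrite divfK // gt_eqF.
  (* Writing 2 as [s (1 + t^2)] makes [s] a common factor of all terms. *)
  rewrite -(ler_pM2l s0); have /= := congr1 (fun x => x * M i i) hs; lra.
pose S := M i i + M j j; pose D := M j i - M i j.
have S0 : 0 <= S by rewrite addr_ge0.
have S1 : 0 < S + 1 by lra.
(* This [t] yields [D^2 (S + 1) <= D^2 S], hence [D = 0]; the added 1 keeps the denominator
   positive. *)
have := rot (D / (S + 1)); rewrite -/S -/D => h.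
have e1 : D / (S + 1) * D = D ^+ 2 * (S + 1) / (S + 1) ^+ 2.
  by field; rewrite gt_eqF.
have e2 : (D / (S + 1)) ^+ 2 * S = D ^+ 2 * S / (S + 1) ^+ 2.
  by field; rewrite gt_eqF.
move: h; rewrite e1 e2 ler_pM2r ?invr_gt0 ?exprn_gt0 // => h.
by apply/eqP; rewrite -subr_eq0 -sqrf_eq0 eq_le sqr_ge0 andbT -/D; lra.
Qed.

Lemma singular_value_decomposition (R : realType) r (M : 'M[R]_r) :
  exists P Q (d : 'rV[R]_r), [/\ orthogonal_mx P, orthogonal_mx Q,
    forall i, 0 <= d 0 i & M = P *m diag_mx d *m Q^T].
Proof.
(* A maximum of [tr (W P^T M Q)] for a weight [W] with distinct positive
   diagonal entries has [W N] and [N W] symmetric, where [N = P^T M Q]. *)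
pose w : 'rV[R]_r := \row_i (i.+1)%:R.
have [|P [Q [hP hQ PQmax]]] := @orthogonal_pair_maximum R r
    (fun P Q => \tr (diag_mx w *m (P^T *m (M *m Q)))).
  move=> T P Q cP cQ; apply: continuous_big => [|i _]; first exact: add_continuous.
  apply: continuous_entries_mulmx => [a b|a b]; first exact: cst_continuous.
  apply: continuous_entries_mulmx => [{}a {}b|{}a {}b].
    by under eq_fun do rewrite mxE; exact: cP.
  by apply: continuous_entries_mulmx => // ? ?; exact: cst_continuous.
pose N := P^T *m (M *m Q).
have [WNs WN0] : (diag_mx w *m N)^T = diag_mx w *m N /\
    forall i, 0 <= (diag_mx w *m N) i i.
  apply: trace_maximal_sym => O hO.
  by rewrite -!mulmxA; apply: PQmax => //; exact: orthogonal_mxM.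
have [NWs _] : (N *m diag_mx w)^T = N *m diag_mx w /\
    forall i, 0 <= (N *m diag_mx w) i i.
  apply: trace_maximal_sym => O hO.
  (* By cyclicity of the trace, [O] acts on the left of [N], which amounts to replacing [P] by
     [P *m O^T]. *)
  rewrite -mulmxA mxtrace_mulC [leRHS]mxtrace_mulC -mulmxA.
  have := PQmax (P *m O^T) Q (orthogonal_mxM hP (orthogonal_mx_tr hO)) hQ.
  by rewrite trmx_mul trmxK -!mulmxA.
have -> : M = P *m N *m Q^T.
  by rewrite /N !mulmxA (mulmx1C hP) mul1mx -mulmxA (mulmx1C hQ) mulmx1.
clearbody N.
have Nd : N = diag_mx (\row_i N i i).
  apply/matrixP => i j; rewrite !mxE; have [->|nij] := eqVneq i j; first by rewrite mulr1n.
  rewrite mulr0n.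
  have := congr1 (fun X : 'M_r => X j i) WNs.
  have := congr1 (fun X : 'M_r => X j i) NWs.
  rewrite mul_mx_diag mul_diag_mx !mxE => e1 e2.
  (* The two symmetries read [w_i N i j = w_j N j i] and [w_j N i j = w_i N j i]; eliminate
     [N j i]. *)
  have : ((i.+1)%:R ^+ 2 - (j.+1)%:R ^+ 2) * N i j = 0.
    rewrite mulrBl !expr2 -!mulrA e2.
    have -> : (i.+1%:R : R) * (j.+1%:R * N j i) = j.+1%:R * (N j i * i.+1%:R) by ring.
    by rewrite -e1; ring.
  move/eqP; rewrite mulf_eq0 subr_eq0 eqrXn2 ?ler0n // eqr_nat eqSS.
  by rewrite (negPf (nij : nat_of_ord i != nat_of_ord j)) => /eqP.
exists P, Q, (\row_i N i i); split; rewrite -?Nd // => i.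
by move: (WN0 i); rewrite mul_diag_mx !mxE pmulr_rge0 ?ltr0n.
Qed.

(** * Frobenius norm and operator bounds *)

Section Norms.
Variable R : realType.

Lemma frob_ge0 n m (A : 'M[R]_(n, m)) : 0 <= frob A.
Proof. exact: sqrtr_ge0. Qed.

Lemma frob_sqr n m (A : 'M[R]_(n, m)) :
  frob A ^+ 2 = \sum_i \sum_j A i j ^+ 2.
Proof.
rewrite sqr_sqrtr // sumr_ge0 // => i _.
by rewrite sumr_ge0 // => j _; exact: sqr_ge0.
Qed.

Lemma frob_le n m n' m' (A : 'M[R]_(n, m)) (B : 'M[R]_(n', m')) :
  frob A ^+ 2 <= frob B ^+ 2 -> frob A <= frob B.
Proof. by rewrite ler_sqr // nnegrE frob_ge0. Qed.

Lemma frob_eq n m n' m' (A : 'M[R]_(n, m)) (B : 'M[R]_(n', m')) :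
  frob A ^+ 2 = frob B ^+ 2 -> frob A = frob B.
Proof. by move=> h; apply/eqP; rewrite eq_le !frob_le // h. Qed.

Lemma frob_le_bound n m (A : 'M[R]_(n, m)) (c : R) :
  0 <= c -> frob A ^+ 2 <= c ^+ 2 -> frob A <= c.
Proof. by move=> c0; rewrite ler_sqr // nnegrE ?frob_ge0. Qed.

Lemma mxtrace_trmul n m (A B : 'M[R]_(n, m)) :
  \tr (A^T *m B) = \sum_i \sum_j A i j * B i j.
Proof.
rewrite exchange_big; apply: eq_bigr => j _.
by rewrite mxE; apply: eq_bigr => i _; rewrite mxE.
Qed.

Lemma frob_sqr_tr n m (A : 'M[R]_(n, m)) : frob A ^+ 2 = \tr (A^T *m A).
Proof.
by rewrite frob_sqr mxtrace_trmul; apply: eq_bigr => i _; apply: eq_bigr => j _.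
Qed.

Lemma frob_trmx n m (A : 'M[R]_(n, m)) : frob A^T = frob A.
Proof. by apply: frob_eq; rewrite !frob_sqr_tr trmxK mxtrace_mulC. Qed.

Lemma frob_eq0 n m (A : 'M[R]_(n, m)) : frob A = 0 -> A = 0.
Proof.
move=> A0; apply/matrixP => i j; rewrite mxE; apply/eqP.
rewrite -sqrf_eq0 eq_le sqr_ge0 andbT.
apply: le_trans (_ : frob A ^+ 2 <= 0); last by rewrite A0 expr0n.
rewrite frob_sqr (bigD1 i) //= (bigD1 j) //= -addrA lerDl addr_ge0 //.
  by rewrite sumr_ge0 // => k _; exact: sqr_ge0.
by rewrite sumr_ge0 // => k _; rewrite sumr_ge0 // => l _; exact: sqr_ge0.
Qed.

Lemma frob0 n m : frob (0 : 'M[R]_(n, m)) = 0.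
Proof.
rewrite /frob big1 ?sqrtr0 // => i _; rewrite big1 // => j _.
by rewrite mxE expr0n.
Qed.

Lemma frobZ n m (c : R) (A : 'M[R]_(n, m)) : frob (c *: A) = `|c| * frob A.
Proof.
apply: (@pexpIrn _ 2); rewrite ?nnegrE ?mulr_ge0 ?frob_ge0 //.
rewrite exprMn real_normK ?num_real // !frob_sqr mulr_sumr.
apply: eq_bigr => i _; rewrite mulr_sumr; apply: eq_bigr => j _.
by rewrite mxE exprMn.
Qed.

Lemma frob_sqrD n m (A B : 'M[R]_(n, m)) :
  frob (A + B) ^+ 2 = frob A ^+ 2 + frob B ^+ 2 + 2 * \tr (A^T *m B).
Proof.
rewrite !frob_sqr mxtrace_trmul mulr_sumr -!big_split /=; apply: eq_bigr => i _.
rewrite mulr_sumr -!big_split /=; apply: eq_bigr => j _.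
by rewrite mxE; ring.
Qed.

(** Cauchy-Schwarz: expand the square of the norm of [frob B *: A - frob A *: B]. *)
Lemma mxtrace_trmul_le n m (A B : 'M[R]_(n, m)) :
  \tr (A^T *m B) <= frob A * frob B.
Proof.
have [A0|A0] := eqVneq (frob A) 0.
  by rewrite A0 (frob_eq0 A0) trmx0 mul0mx mxtrace0 mul0r.
have [B0|B0] := eqVneq (frob B) 0.
  by rewrite B0 (frob_eq0 B0) mulmx0 mxtrace0 mulr0.
have ab : 0 < frob A * frob B by rewrite mulr_gt0 // lt_neqAle eq_sym ?A0 ?B0 frob_ge0.
have := sqr_ge0 (frob (frob B *: A + - frob A *: B)).
rewrite frob_sqrD !frobZ normrN !ger0_norm ?frob_ge0 //.
have -> : \tr ((frob B *: A)^T *m (- frob A *: B)) = - (frob A * frob B * \tr (A^T *m B)).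
  rewrite (_ : (frob B *: A)^T = frob B *: A^T); last by rewrite linearZ.
  by rewrite -scalemxAl -scalemxAr scalerA mxtraceZ mulrN mulNr (mulrC (frob B)).
move=> h; rewrite -(ler_pM2l ab); lra.
Qed.

Lemma frobN n m (A : 'M[R]_(n, m)) : frob (- A) = frob A.
Proof. by rewrite -scaleN1r frobZ normrN1 mul1r. Qed.

Lemma frobD n m (A B : 'M[R]_(n, m)) : frob (A + B) <= frob A + frob B.
Proof.
apply: frob_le_bound; first by rewrite addr_ge0 ?frob_ge0.
rewrite frob_sqrD; have := mxtrace_trmul_le A B; nra.
Qed.

Lemma frobB n m (A B : 'M[R]_(n, m)) : frob (A - B) <= frob A + frob B.
Proof. by rewrite -(frobN B); exact: frobD. Qed.

(** * Orthonormal frames, complementary projections and operator bounds *)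

Definition frame n k (F : 'M[R]_(n, k)) : Prop := F^T *m F = 1%:M.

Definition coproj n k (F : 'M[R]_(n, k)) : 'M[R]_n := 1%:M - F *m F^T.

Lemma coproj_tr n k (F : 'M[R]_(n, k)) : (coproj F)^T = coproj F.
Proof. by rewrite /coproj linearB /= trmx1 trmx_mul trmxK. Qed.

Lemma coproj_frame n k (F : 'M[R]_(n, k)) : frame F -> coproj F *m F = 0.
Proof. by move=> hF; rewrite mulmxBl mul1mx -mulmxA hF mulmx1 subrr. Qed.

Lemma coproj_idem n k (F : 'M[R]_(n, k)) :
  frame F -> coproj F *m coproj F = coproj F.
Proof.
by move=> hF; rewrite [X in _ *m X]/coproj mulmxBr mulmx1 mulmxA coproj_frame // mul0mx subr0.
Qed.

Lemma frob_frame n k p (F : 'M[R]_(n, k)) (B : 'M[R]_(k, p)) :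
  frame F -> frob (F *m B) = frob B.
Proof.
by move=> hF; apply: frob_eq; rewrite !frob_sqr_tr trmx_mul mulmxA -(mulmxA B^T) hF mulmx1.
Qed.

Lemma frob_pythagoras n k p (F : 'M[R]_(n, k)) (B : 'M[R]_(n, p)) :
  frame F -> frob B ^+ 2 = frob (F^T *m B) ^+ 2 + frob (coproj F *m B) ^+ 2.
Proof.
move=> hF; rewrite !frob_sqr_tr !trmx_mul trmxK coproj_tr -linearD /=.
have -> : B^T *m coproj F *m (coproj F *m B) = B^T *m (coproj F *m B).
  by rewrite -mulmxA (mulmxA (coproj F)) coproj_idem.
rewrite /coproj mulmxBl mul1mx mulmxBr !mulmxA.
by rewrite addrC subrK.
Qed.

(** An upper bound on the spectral norm, tested on matrices of any width: it then applies to
    Frobenius norms of products and composes without handling suprema. The sign of [c] is explicit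
    because the test is void for [m = 0]. *)
Definition op_bounded n m (A : 'M[R]_(n, m)) (c : R) : Prop :=
  0 <= c /\ forall k (B : 'M[R]_(m, k)), frob (A *m B) <= c * frob B.

Lemma op_bounded_le n m (A : 'M[R]_(n, m)) (c d : R) :
  op_bounded A c -> c <= d -> op_bounded A d.
Proof.
move=> [c0 hA] cd; split=> [|k B]; first exact: le_trans cd.
by apply: le_trans (hA _ _) _; rewrite ler_wpM2r ?frob_ge0.
Qed.

Lemma op_boundedM n m p (A : 'M[R]_(n, m)) (B : 'M[R]_(m, p)) c d :
  op_bounded A c -> op_bounded B d -> op_bounded (A *m B) (c * d).
Proof.
move=> [c0 hA] [d0 hB]; split=> [|k C]; first exact: mulr_ge0.
by rewrite -mulmxA; apply: le_trans (hA _ _) _; rewrite -mulrA ler_wpM2l.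
Qed.

Lemma op_boundedD n m (A B : 'M[R]_(n, m)) c d :
  op_bounded A c -> op_bounded B d -> op_bounded (A + B) (c + d).
Proof.
move=> [c0 hA] [d0 hB]; split=> [|k C]; first exact: addr_ge0.
by rewrite mulmxDl mulrDl; apply: le_trans (frobD _ _) _; rewrite lerD.
Qed.

Lemma op_boundedN n m (A : 'M[R]_(n, m)) c : op_bounded A c -> op_bounded (- A) c.
Proof. by move=> [c0 hA]; split=> // k C; rewrite mulNmx frobN. Qed.

Lemma op_boundedB n m (A B : 'M[R]_(n, m)) c d :
  op_bounded A c -> op_bounded B d -> op_bounded (A - B) (c + d).
Proof. by move=> hA hB; apply: op_boundedD => //; exact: op_boundedN. Qed.

(** Duality: [||A^T B||^2] is the inner product of [B] with [A A^T B], so it is at most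
    [c ||B|| ||A^T B||]; divide by [||A^T B||]. *)
Lemma op_bounded_trmx n m (A : 'M[R]_(n, m)) c : op_bounded A c -> op_bounded A^T c.
Proof.
move=> [c0 hA]; split=> // k B.
have [->|N0] := eqVneq (frob (A^T *m B)) 0; first by rewrite mulr_ge0 ?frob_ge0.
have Np : 0 < frob (A^T *m B) by rewrite lt_neqAle eq_sym N0 frob_ge0.
rewrite -(ler_pM2r Np) -expr2 frob_sqr_tr trmx_mul trmxK -mulmxA.
apply: le_trans (mxtrace_trmul_le _ _) _.
by rewrite mulrAC mulrC ler_wpM2r ?frob_ge0.
Qed.

Lemma op_bounded_frame n k (F : 'M[R]_(n, k)) : frame F -> op_bounded F 1.
Proof. by move=> hF; split=> // p B; rewrite frob_frame // mul1r. Qed.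

Lemma op_bounded_coproj n k (F : 'M[R]_(n, k)) : frame F -> op_bounded (coproj F) 1.
Proof.
move=> hF; split=> // p B; rewrite mul1r frob_le // (frob_pythagoras B hF).
by rewrite lerDr sqr_ge0.
Qed.

Lemma op_bounded_diag n (d : 'rV[R]_n) c :
  0 <= c -> (forall i, `|d 0 i| <= c) -> op_bounded (diag_mx d) c.
Proof.
move=> c0 hd; split=> // k B; apply: frob_le_bound; first by rewrite mulr_ge0 ?frob_ge0.
rewrite exprMn !frob_sqr mulr_sumr ler_sum // => i _; rewrite mulr_sumr ler_sum // => j _.
rewrite mul_diag_mx mxE exprMn ler_wpM2r ?sqr_ge0 //.
by rewrite -[leLHS]real_normK ?num_real // ler_sqr ?nnegrE.
Qed.

Lemma frob_sqr_col n m (A : 'M[R]_(n, m)) :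
  frob A ^+ 2 = \sum_j frob (col j A) ^+ 2.
Proof.
rewrite frob_sqr exchange_big; apply: eq_bigr => j _; rewrite frob_sqr.
by apply: eq_bigr => i _; rewrite big_ord1 mxE.
Qed.

Lemma op_bounded_col n m (A : 'M[R]_(n, m)) c : 0 <= c ->
  (forall x : 'cV[R]_m, frob (A *m x) <= c * frob x) -> op_bounded A c.
Proof.
move=> c0 hA; split=> // k B; apply: frob_le_bound; first by rewrite mulr_ge0 ?frob_ge0.
rewrite exprMn !frob_sqr_col mulr_sumr ler_sum // => j _.
rewrite (_ : col j (A *m B) = A *m col j B); last by rewrite !colE mulmxA.
by rewrite -exprMn lerXn2r // ?nnegrE ?mulr_ge0 ?frob_ge0.
Qed.

Lemma mxtrace_trmul_sqr_le n m (A B : 'M[R]_(n, m)) :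
  \tr (A^T *m B) ^+ 2 <= (frob A * frob B) ^+ 2.
Proof.
rewrite -[leLHS]real_normK ?num_real // lerXn2r ?nnegrE ?mulr_ge0 ?frob_ge0 //.
rewrite ler_norml mxtrace_trmul_le andbT lerNl.
have -> : - \tr (A^T *m B) = \tr (A^T *m - B) by rewrite mulmxN linearN.
by rewrite -(frobN B) mxtrace_trmul_le.
Qed.

Lemma op_bounded_frob n m (A : 'M[R]_(n, m)) : op_bounded A (frob A).
Proof.
apply: op_bounded_col => [|x]; first exact: frob_ge0.
apply: frob_le_bound; first by rewrite mulr_ge0 ?frob_ge0.
rewrite -(frob_trmx A) exprMn frob_sqr frob_sqr_col mulr_suml ler_sum // => i _.
rewrite big_ord1 -exprMn; apply: le_trans (mxtrace_trmul_sqr_le _ _).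
by rewrite trace_mx11 tr_col trmxK -row_mul [X in _ <= X ^+ 2]mxE.
Qed.

Lemma specnorm_has_sup n m (A : 'M[R]_(n, m)) :
  has_sup [set frob (A *m x) | x in [set x : 'cV[R]_m | frob x <= 1]].
Proof.
split; first by exists (frob (A *m (0 : 'cV[R]_m))), 0 => //=; rewrite frob0 ler01.
exists (frob A) => _ [x /= x1 <-]; apply: le_trans (proj2 (op_bounded_frob A) _ x) _.
by rewrite ler_piMr // frob_ge0.
Qed.

(** Homogeneity extends the supremum over the unit ball to all vectors, and columns extend it to
    matrices. Together with [specnorm_le], this makes the spectral norm the least operator bound. *)
Lemma specnorm_op_bounded n m (A : 'M[R]_(n, m)) : op_bounded A (specnorm A).
Proof.
have ub (x : 'cV[R]_m) : frob x <= 1 -> frob (A *m x) <= specnorm A.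
  by move=> x1; apply: (sup_upper_bound (specnorm_has_sup A)); exists x.
apply: op_bounded_col => [|x].
  by apply: le_trans (ub 0 _); [exact: frob_ge0|rewrite frob0 ler01].
have [x0|x0] := eqVneq (frob x) 0.
  by rewrite x0 (frob_eq0 x0) mulmx0 frob0 mulr0.
have xp : 0 < frob x by rewrite lt_neqAle eq_sym x0 frob_ge0.
have := ub ((frob x)^-1 *: x); rewrite -scalemxAr !frobZ ger0_norm ?invr_ge0 ?frob_ge0 //.
by rewrite mulVf // => /(_ (lexx _)); rewrite ler_pdivrMl // mulrC.
Qed.

Lemma specnorm_le n m (A : 'M[R]_(n, m)) c : op_bounded A c -> specnorm A <= c.
Proof.
move=> [c0 hA]; apply: ge_sup; first by case: (specnorm_has_sup A).
move=> _ [x /= x1 <-]; apply: le_trans (hA _ x) _.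
by rewrite ler_piMr.
Qed.

Lemma specnorm_ge0 n m (A : 'M[R]_(n, m)) : 0 <= specnorm A.
Proof. by case: (specnorm_op_bounded A). Qed.

End Norms.

(** * Truncated singular value decompositions *)

Section Truncation.
Variable R : realType.
Implicit Types s t : nat -> R.

Lemma eq_diag_rect n m s t : (forall k, (k < minn n m)%N -> s k = t k) ->
  diag_rect n m s = diag_rect n m t.
Proof.
move=> st; apply/matrixP => i j; rewrite !mxE; case: eqP => // ij.
by apply: st; rewrite leq_min ltn_ord ij ltn_ord.
Qed.

Lemma diag_rect_tr n m s : (diag_rect n m s)^T = diag_rect m n s.
Proof. by apply/matrixP => i j; rewrite !mxE eq_sym; case: eqP => // ->. Qed.

Lemma diag_rectB n m s t :
  diag_rect n m s - diag_rect n m t = diag_rect n m (fun k => s k - t k).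
Proof. by apply/matrixP => i j; rewrite !mxE; case: eqP => // _; rewrite subr0. Qed.

Lemma diag_rect_diag n s : diag_rect n n s = diag_mx (\row_i s i).
Proof.
apply/matrixP => i j; rewrite !mxE -val_eqE /=.
by case: eqP => _; rewrite ?mulr1n ?mulr0n.
Qed.

Lemma diag_rect1 n : diag_rect n n (fun=> 1) = 1%:M :> 'M[R]_n.
Proof. by apply/matrixP => i j; rewrite !mxE -val_eqE /=; case: eqP. Qed.

Lemma diag_rectM n m p s t : diag_rect n m s *m diag_rect m p t =
  diag_rect n p (fun k => if (k < m)%N then s k * t k else 0).
Proof.
apply/matrixP => i j; rewrite !mxE; case: (ltnP i m) => im.
  rewrite (bigD1 (Ordinal im)) //= big1 => [|k kN].
    by rewrite !mxE eqxx addr0 /=; case: eqP => // _; rewrite mulr0.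
  rewrite !mxE; case: eqP => [ik|_]; last by rewrite mul0r.
  by case/eqP: kN; apply: val_inj.
rewrite if_same big1 // => k _; rewrite !mxE; case: eqP => [ik|_]; last by rewrite mul0r.
by have := ltn_ord k; rewrite -ik ltnNge im.
Qed.

Lemma frob_diag_rect_mul n m k s (C : 'M[R]_(m, k)) :
  frob (diag_rect n m s *m C) ^+ 2 =
  \sum_(i < m) (if (i < n)%N then s i ^+ 2 else 0) * \sum_j C i j ^+ 2.
Proof.
rewrite frob_sqr_tr trmx_mul diag_rect_tr -mulmxA (mulmxA (diag_rect _ _ _)).
rewrite diag_rectM diag_rect_diag mxtrace_trmul; apply: eq_bigr => i _.
rewrite mulr_sumr; apply: eq_bigr => j _; rewrite mul_diag_mx !mxE.
by case: ifP => _; rewrite ?expr2; ring.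
Qed.

(** Column selection as multiplication by a rectangular identity turns every truncation into a
    product of [diag_rect] matrices. *)
Lemma lead_colsE n r (U : 'M[R]_n) : (r <= n)%N ->
  lead_cols r U = U *m diag_rect n r (fun=> 1).
Proof.
move=> rn; apply/matrixP => i j; rewrite !mxE.
have jn : (j < n)%N by apply: leq_trans rn.
rewrite insubT (bigD1 (Ordinal jn)) //= big1 => [|k kN].
  by rewrite mxE eqxx mulr1 addr0; congr (U i _); apply: val_inj.
rewrite mxE; case: eqP => [kj|_]; last by rewrite mulr0.
by case/eqP: kN; apply: val_inj.
Qed.

Lemma lead_cols_frame n r (U : 'M[R]_n) :
  (r <= n)%N -> orthogonal_mx U -> frame (lead_cols r U).
Proof.
move=> rn hU; rewrite /frame lead_colsE // trmx_mul mulmxA -(mulmxA _ U^T) hU mulmx1.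
rewrite diag_rect_tr diag_rectM -[RHS]diag_rect1; apply: eq_diag_rect => k.
by rewrite minnn => kr; rewrite (leq_trans kr rn) mulr1.
Qed.

Lemma is_svd_trmx n m (A : 'M[R]_(n, m)) U s V : is_svd A U s V -> is_svd A^T V s U.
Proof.
move=> [hU hV hs s0 ->]; split=> //; first by move=> i; rewrite minnC; exact: s0.
by rewrite !trmx_mul trmxK diag_rect_tr mulmxA.
Qed.

Lemma svd_lead_cols n m r (A : 'M[R]_(n, m)) U s V : (r <= minn n m)%N ->
  is_svd A U s V -> A *m lead_cols r V = lead_cols r U *m lead_sigma r s.
Proof.
rewrite leq_min => /andP[rn rm] [hU hV _ _ ->].
rewrite !lead_colsE // mulmxA -(mulmxA _ V^T) hV mulmx1 /lead_sigma -!mulmxA !diag_rectM.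
congr (_ *m _); apply: eq_diag_rect => k; rewrite leq_min => /andP[_ kr].
by rewrite kr (leq_trans kr rm) mulr1 mul1r.
Qed.

Lemma svd_coproj n m r (A : 'M[R]_(n, m)) U s V : (r <= minn n m)%N ->
  is_svd A U s V -> A *m coproj (lead_cols r V) =
  U *m diag_rect n m (fun k => if (k < r)%N then 0 else s k) *m V^T.
Proof.
move=> rnm hA; rewrite mulmxBr mulmx1 mulmxA (svd_lead_cols rnm hA).
move: rnm hA; rewrite leq_min => /andP[rn rm] [hU hV _ _ ->].
rewrite !lead_colsE // trmx_mul diag_rect_tr /lead_sigma -!mulmxA.
rewrite (mulmxA (diag_rect r r s)) diag_rectM (mulmxA (diag_rect n r _)) diag_rectM.
rewrite -mulmxBr -mulmxBl diag_rectB; congr (_ *m (_ *m _)); apply: eq_diag_rect => k _.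
by case: ltnP => _; rewrite ?subr0 // mul1r mulr1 subrr.
Qed.

(** Both sides are the part of [A] beyond its first [r] singular values, by [svd_coproj] for [A] and
    for [A^T]. *)
Lemma svd_coproj_comm n m r (A : 'M[R]_(n, m)) U s V : (r <= minn n m)%N ->
  is_svd A U s V -> A *m coproj (lead_cols r V) = coproj (lead_cols r U) *m A.
Proof.
move=> rnm hA; have hT := is_svd_trmx hA; rewrite minnC in rnm.
have := svd_coproj rnm hT; rewrite minnC in rnm; rewrite (svd_coproj rnm hA).
move/(congr1 trmx); rewrite trmx_mul trmxK coproj_tr => ->.
by rewrite !trmx_mul trmxK diag_rect_tr mulmxA.
Qed.

Lemma op_bounded_diag_rect n m s c : 0 <= c -> (forall k, `|s k| <= c) ->
  op_bounded (diag_rect n m s) c.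
Proof.
move=> c0 sc; split=> // k B; apply: frob_le_bound; first by rewrite mulr_ge0 ?frob_ge0.
rewrite frob_diag_rect_mul exprMn frob_sqr mulr_sumr ler_sum // => i _.
rewrite ler_wpM2r //; first by rewrite sumr_ge0 // => j _; exact: sqr_ge0.
case: ifP => _; last exact: sqr_ge0.
by rewrite -[leLHS]real_normK ?num_real // ler_sqr ?nnegrE.
Qed.

Lemma svd_coproj_op_bounded n m r (A : 'M[R]_(n, m)) U s V : (r <= minn n m)%N ->
  is_svd A U s V -> op_bounded (A *m coproj (lead_cols r V)) (s r).
Proof.
move=> rnm hA; rewrite (svd_coproj rnm hA); have [hU hV [smono s0] _ _] := hA.
rewrite -[s r]mulr1 -[s r]mul1r; apply: op_boundedM; last first.
  by apply: op_bounded_trmx; exact: op_bounded_frame.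
apply: op_boundedM; first exact: op_bounded_frame.
apply: op_bounded_diag_rect => // k; case: ltnP => kr; first by rewrite normr0.
by rewrite ger0_norm // smono.
Qed.

(** * Singular value sums with bounded weights *)

Lemma op_bounded_row n m (C : 'M[R]_(n, m)) c i :
  op_bounded C c -> \sum_j C i j ^+ 2 <= c ^+ 2.
Proof.
move=> /op_bounded_trmx [c0 /(_ _ (delta_mx i 0 : 'cV_n)) hC].
have e1 : frob (delta_mx i 0 : 'cV[R]_n) = 1.
  apply: (@pexpIrn _ 2); rewrite ?nnegrE ?frob_ge0 // frob_sqr_tr trace_mx11 expr1n.
  by rewrite -[_^T]mulmx1 mulmx_delta_entry mxE eqxx.
have -> : \sum_j C i j ^+ 2 = frob (C^T *m (delta_mx i 0 : 'cV_n)) ^+ 2.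
  by rewrite -colE frob_sqr; apply: eq_bigr => j _; rewrite big_ord1 !mxE.
by rewrite lerXn2r ?nnegrE ?frob_ge0 //; move: hC; rewrite e1 mulr1.
Qed.

Lemma op_bounded_sum_sqr n k (C : 'M[R]_(n, k)) c :
  op_bounded C c -> \sum_i \sum_j C i j ^+ 2 <= k%:R * c ^+ 2.
Proof.
move=> /op_bounded_trmx hC; rewrite exchange_big /=.
rewrite (_ : k%:R * _ = \sum_(j < k) c ^+ 2); last by rewrite sumr_const card_ord mulr_natl.
apply: ler_sum => j _; apply: le_trans (op_bounded_row j hC).
by apply: ler_sum => i _; rewrite mxE.
Qed.

Lemma ler_sum_nat_widen (f : nat -> R) k l : (k <= l)%N -> (forall i, 0 <= f i) ->
  \sum_(i < k) f i <= \sum_(i < l) f i.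
Proof.
move=> kl f0; rewrite -!(big_mkord xpredT f) (big_cat_nat (leq0n k) kl) //= lerDl.
by rewrite sumr_ge0.
Qed.

(** The sum is largest when all the weight sits on the [k] largest admissible terms. With the
    threshold [t = x (p + k)], each term is at most [c] times the excess of [x i] over [t], plus
    [t * w i]; the [t] parts then cancel against the total weight. *)
Lemma weighted_sum_upper (x : nat -> R) m p k (w : 'I_m -> R) c :
  (forall i j, (i <= j)%N -> x j <= x i) -> (forall i, 0 <= x i) ->
  (forall i, 0 <= w i <= c) -> \sum_i w i <= k%:R * c ->
  \sum_(i < m) (if (i < p)%N then 0 else x i) * w i <= c * \sum_(j < k) x (p + j)%N.
Proof.
move=> xmono x0 wc wsum; pose t := x (p + k)%N.
pose g i := if (p <= i < p + k)%N then x i - t else 0.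
have g0 i : 0 <= g i.
  by rewrite /g; case: ifP => // /andP[_ ip]; rewrite subr_ge0 xmono // ltnW.
have c0 : m != 0 -> 0 <= c.
  case: m w wc wsum => // m w wc _ _; have /andP[h1 h2] := wc ord0; exact: le_trans h2.
have le1 (i : 'I_m) : (if (i < p)%N then 0 else x i) * w i <= g i * c + t * w i.
  have /andP[w0 w1] := wc i; rewrite /g; case: ltnP => ip /=.
    by rewrite mul0r mul0r add0r mulr_ge0 // x0.
  case: ltnP => ipk.
    have : (x i - t) * w i <= (x i - t) * c by rewrite ler_wpM2l // subr_ge0 xmono // ltnW.
    lra.
  by rewrite mul0r add0r ler_wpM2r // xmono.
(* Without any index [i], the sign of [c] must come from [0 <= k c] instead. *)
case: (eqVneq m 0) => [m0|/c0{}c0].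
  move: w wc wsum le1; rewrite m0 => w wc; rewrite !big_ord0 => wsum _.
  have [->|k0] := eqVneq k 0%N; first by rewrite big_ord0 mulr0.
  rewrite mulr_ge0 ?sumr_ge0 //; move: wsum; rewrite pmulr_rge0 // ltr0n lt0n //.
apply: le_trans (ler_sum _ (fun i _ => le1 i)) _.
rewrite big_split /= -mulr_suml -mulr_sumr.
have gsum : \sum_(i < m) g i <= \sum_(j < k) x (p + j)%N - k%:R * t.
  (* The range is widened so that it contains the whole block from [p] to [p + k], which may exceed
     [m]. *)
  have le2 : (m <= m + (p + k))%N by rewrite leq_addr.
  apply: le_trans (ler_sum_nat_widen le2 g0) _.
  rewrite -(big_mkord xpredT g) (@big_cat_nat _ _ _ p 0%N) //=; last by lia.
  rewrite (@big_cat_nat _ _ _ (p + k)%N p) //=; [|lia|lia].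
  rewrite big_nat_cond big1 => [|i]; last by rewrite /g; case: ifP => //; lia.
  rewrite [X in _ + (_ + X)]big_nat_cond [X in _ + (_ + X)]big1 => [|i]; last first.
    by rewrite /g; case: ifP => //; lia.
  rewrite add0r addr0 -{1}[p]add0n big_addn addKn big_mkord.
  rewrite (_ : k%:R * t = \sum_(j < k) t); last by rewrite sumr_const card_ord mulr_natl.
  rewrite -sumrB ler_sum // => j _; rewrite /g addnC ifT //.
  by rewrite leq_addr ltn_add2l ltn_ord.
have t0 : 0 <= t by exact: x0.
have := ler_wpM2r c0 gsum; have := ler_wpM2l t0 wsum; lra.
Qed.

(** The opposite extreme: the sum is smallest when the weight sits on the last [p] terms. The
    threshold is [x r], and its multiples cancel because the weights sum to exactly [p]. *)
Lemma weighted_sum_lower (x : nat -> R) r p (w : 'I_(r + p) -> R) :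
  (forall i j, (i <= j)%N -> x j <= x i) ->
  (forall i, 0 <= w i <= 1) -> \sum_i w i = p%:R ->
  \sum_(j < p) x (r + j)%N <= \sum_(i < r + p) x i * w i.
Proof.
move=> xmono wc wsum.
have le1 (i : 'I_(r + p)) :
    x r * w i + (if (r <= i)%N then x i - x r else 0) <= x i * w i.
  have /andP[w0 w1] := wc i; case: leqP => ri.
    have : (x r - x i) * w i <= (x r - x i) * 1 by rewrite ler_wpM2l // subr_ge0 xmono.
    lra.
  by rewrite addr0 ler_wpM2r // xmono // ltnW.
apply: le_trans (ler_sum _ (fun i _ => le1 i)).
rewrite big_split /= -mulr_sumr wsum big_split_ord /=.
rewrite [X in _ + (X + _)]big1 => [|i _]; last first.
  by rewrite leqNgt ltn_ord.
rewrite add0r; under [X in _ <= _ + X]eq_bigr do rewrite leq_addr.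
by rewrite sumrB sumr_const card_ord mulr_natr; lra.
Qed.

(** The squared row norms of [V^T B] are weights in [[0, c^2]] with total at most [k c^2], so
    [weighted_sum_upper] applies to the squared singular values. *)
Lemma svd_frob_le n m p k K (A : 'M[R]_(n, m)) U s V (B : 'M[R]_(m, k)) c :
  is_svd A U s V -> op_bounded B c -> (k <= K)%N ->
  frob (U *m diag_rect n m (fun i => if (i < p)%N then 0 else s i) *m V^T *m B) <=
  c * Num.sqrt (\sum_(j < K) s (p + j)%N ^+ 2).
Proof.
move=> [hU hV [smono s0] _ _] hB kK; have c0 := proj1 hB.
apply: frob_le_bound; first by rewrite mulr_ge0 ?sqrtr_ge0.
rewrite exprMn [X in _ <= _ * X]sqr_sqrtr; last by rewrite sumr_ge0 // => j _; exact: sqr_ge0.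
rewrite -!mulmxA frob_frame // frob_diag_rect_mul.
set C := V^T *m B.
have hC : op_bounded C c.
  rewrite -[c]mul1r; apply: op_boundedM hB.
  by apply: op_bounded_trmx; exact: op_bounded_frame.
pose x i := s i ^+ 2.
have xmono i j : (i <= j)%N -> x j <= x i.
  by move=> ij; rewrite /x lerXn2r ?nnegrE ?s0 // smono.
have x0 i : 0 <= x i by exact: sqr_ge0.
apply: le_trans (_ : c ^+ 2 * (\sum_(j < k) x (p + j)%N) <= _); last first.
  by rewrite ler_wpM2l ?sqr_ge0 // (@ler_sum_nat_widen (fun j => x (p + j)%N)).
apply: le_trans (@weighted_sum_upper x m p k (fun i => \sum_j C i j ^+ 2) _ xmono x0 _ _).
- apply: ler_sum => i _; rewrite ler_wpM2r //; first by rewrite sumr_ge0 // => j _; exact: sqr_ge0.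
  rewrite /x; case: ltnP => _; case: ltnP => _ //; rewrite ?expr0n //; exact: sqr_ge0.
- by move=> i; rewrite op_bounded_row // andbT sumr_ge0 // => j _; exact: sqr_ge0.
- exact: op_bounded_sum_sqr.
Qed.

Lemma svd_coproj_frob_le n m r k (A : 'M[R]_(n, m)) U s V (B : 'M[R]_(m, k)) c :
  (r <= minn n m)%N -> is_svd A U s V -> op_bounded B c -> (k <= r)%N ->
  frob (A *m coproj (lead_cols r V) *m B) <= c * tail_frob r s.
Proof.
by move=> rnm hA hB kr; rewrite (svd_coproj rnm hA); exact: (svd_frob_le r hA hB kr).
Qed.

Lemma hard_thr_frob_ge n m r (U : 'M[R]_n) s (V : 'M[R]_m) :
  (r <= minn n m)%N -> orthogonal_mx U -> orthogonal_mx V ->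
  Num.sqrt (\sum_(j < r) s j ^+ 2) <= frob (hard_thr r U s V).
Proof.
rewrite leq_min => /andP[rn rm] hU hV.
rewrite /hard_thr -(frob_trmx (_ *m _)) trmx_mul trmxK frob_frame // frob_trmx frob_frame //.
set D := diag_rect _ _ _; rewrite -[D]mulmx1.
apply: (@le_trans _ _ (Num.sqrt (frob (D *m 1%:M) ^+ 2))); last first.
  by rewrite sqrtr_sqr ger0_norm ?frob_ge0.
rewrite ler_wsqrtr // frob_diag_rect_mul.
pose f i := if (i < r)%N then s i ^+ 2 else 0.
have f0 i : 0 <= f i by rewrite /f; case: ifP => // _; exact: sqr_ge0.
apply: le_trans (_ : \sum_(i < m) f i <= _).
  apply: le_trans (ler_sum_nat_widen rm f0).
  by apply: ler_sum => i _; rewrite /f ltn_ord.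
apply: ler_sum => i _; rewrite (bigD1 i) //= mxE eqxx expr1n big1 => [|j ji].
  rewrite addr0 mulr1 /f; case: (ltnP i r) => ir; first by rewrite (leq_trans ir rn).
  by rewrite expr0n if_same.
by rewrite mxE eq_sym (negPf ji) expr0n.
Qed.

Lemma svd_hard_thr_frob_le n m r k (E : 'M[R]_(n, m)) U s V (B : 'M[R]_(m, k)) c :
  (r <= minn n m)%N -> is_svd E U s V -> op_bounded B c -> (k <= r)%N ->
  frob (E *m B) <= c * frob (hard_thr r U s V).
Proof.
move=> rnm hE hB kr; have [hU hV _ _ eE] := hE.
apply: le_trans (_ : c * Num.sqrt (\sum_(j < r) s (0 + j)%N ^+ 2) <= _).
  by have := @svd_frob_le _ _ 0 _ _ _ _ _ _ _ _ hE hB kr;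
    rewrite /= -[diag_rect _ _ _]/(diag_rect n m s) -eE.
by rewrite ler_wpM2l ?(proj1 hB) // hard_thr_frob_ge.
Qed.

(** Induction by dimension count: [C] stacked on [Y^T] has fewer than [q] rows, hence a kernel
    vector; normalized, it is the next column. *)
Lemma kernel_frame r q (C : 'M[R]_(r, q)) k : (r + k <= q)%N ->
  exists Y : 'M[R]_(q, k), frame Y /\ C *m Y = 0.
Proof.
elim: k => [_|k IHk rkq].
  by exists 0; split; [apply/matrixP => -[]|rewrite mulmx0].
have [|Y [hY CY]] := IHk; first by lia.
pose M := col_mx C Y^T.
have rk : (\rank M^T < q)%N by rewrite mxrank_tr; apply: leq_ltn_trans (rank_leq_row _) _; lia.
have : kermx M^T != 0 by rewrite -mxrank_eq0 mxrank_ker -lt0n subn_gt0.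
case/rowV0Pn => x /sub_kermxP xM x0.
have My : M *m x^T = 0 by rewrite -[M]trmxK -trmx_mul xM trmx0.
have fx : frob x^T != 0 by apply: contra_neq x0 => /frob_eq0 h; rewrite -[x]trmxK h trmx0.
pose y : 'cV_q := (frob x^T)^-1 *: x^T.
have : M *m y = 0 by rewrite -scalemxAr My scaler0.
rewrite /M mul_col_mx -[0 in RHS]vsubmxK => /eq_col_mx []; rewrite !linear0 => Cy Yy.
have yy : y^T *m y = 1%:M.
  rewrite [_ *m _]mx11_scalar -trace_mx11 -frob_sqr_tr frobZ ger0_norm ?invr_ge0 ?frob_ge0 //.
  by rewrite mulVf // expr1n.
have CyY : C *m row_mx y Y = 0 by rewrite mul_mx_row Cy CY row_mx0.
have hyY : frame (row_mx y Y).
  rewrite /frame tr_row_mx mul_col_row yy Yy hY -[y^T *m Y]trmxK trmx_mul trmxK Yy trmx0.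
  by rewrite -scalar_mx_block.
by exists (row_mx y Y : 'M_(q, 1 + k)).
Qed.

(** Inside the span of the first [r + p] right singular vectors there are [p] orthonormal directions
    orthogonal to the [r] columns of [G]. The squared row norms of their coordinates are weights in
    [[0, 1]] of total [p]. *)
Lemma svd_minimax n m r p (B : 'M[R]_(n, m)) U s V (G : 'M[R]_(m, r)) :
  (r + p <= minn n m)%N -> is_svd B U s V ->
  exists F : 'M[R]_(m, p), [/\ frame F, G^T *m F = 0 &
    \sum_(j < p) s (r + j)%N ^+ 2 <= frob (B *m F) ^+ 2].
Proof.
rewrite leq_min => /andP[rpn rpm] [hU hV [smono s0] _ ->].
have [|Y [hY CY]] := @kernel_frame r (r + p) (G^T *m lead_cols (r + p) V) p; first by [].
have hF := lead_cols_frame rpm hV.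
exists (lead_cols (r + p) V *m Y); split; last 1 first.
- rewrite lead_colsE // !mulmxA -(mulmxA _ V^T) hV mulmx1 -!mulmxA frob_frame //.
  rewrite mulmxA diag_rectM frob_diag_rect_mul.
  apply: le_trans (@weighted_sum_lower (fun i => s i ^+ 2) r p
    (fun i => \sum_j Y i j ^+ 2) _ _ _) _.
  + by move=> i j ij; rewrite lerXn2r ?nnegrE ?s0 // smono.
  + move=> i; have := op_bounded_row i (op_bounded_frame hY); rewrite expr1n => ->.
    by rewrite andbT sumr_ge0 // => j _; exact: sqr_ge0.
  + by rewrite -frob_sqr frob_sqr_tr hY mxtrace1.
  by apply: ler_sum => i _; rewrite !(leq_trans (ltn_ord i)) // mulr1.
- by rewrite /frame trmx_mul mulmxA -(mulmxA Y^T) hF mulmx1.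
- by rewrite mulmxA.
Qed.

(** A unit vector orthogonal to the first [k] right singular vectors of [A] can be stretched by
    [A + E] by at least [s' k], while [A] stretches it by at most [s k]. *)
Lemma svd_weyl n m k (A E : 'M[R]_(n, m)) U s V U' s' V' e :
  is_svd A U s V -> is_svd (A + E) U' s' V' -> op_bounded E e -> s' k <= s k + e.
Proof.
move=> hA hB hE; have [_ _ [_ s0] _ _] := hA; have [_ _ _ s'0 _] := hB.
case: (leqP (minn n m) k) => [|kmin]; first by move/s'0 => ->; rewrite addr_ge0 ?(proj1 hE).
have km : (k + 1 <= minn n m)%N by rewrite addn1.
have [F [hF GF]] := svd_minimax (lead_cols k V) km hB.
rewrite big_ord1 addn0 => h.
have F1 : frob F = 1.
  by apply: (@pexpIrn _ 2); rewrite ?nnegrE ?frob_ge0 // frob_sqr_tr hF mxtrace1 expr1n.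
apply: le_trans (_ : frob ((A + E) *m F) <= _).
  by rewrite -ler_sqr ?nnegrE ?frob_ge0 //; case: hB => _ _ [_ ->].
rewrite mulmxDl; apply: le_trans (frobD _ _) (lerD _ _); last first.
  by have := proj2 hE _ F; rewrite F1 mulr1.
have -> : A *m F = A *m coproj (lead_cols k V) *m F.
  by rewrite -mulmxA /coproj mulmxBl mul1mx -mulmxA GF mulmx0 subr0.
by have := proj2 (svd_coproj_op_bounded (ltnW kmin) hA) _ F; rewrite F1 mulr1.
Qed.

Lemma tail_frob_perturbation n m r (A E : 'M[R]_(n, m)) U s V U' s' V' Ue se Ve :
  (r <= minn n m)%N -> is_svd A U s V -> is_svd (A + E) U' s' V' -> is_svd E Ue se Ve ->
  tail_frob r s' <= tail_frob r s + frob (hard_thr r Ue se Ve).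
Proof.
move=> rnm hA hB hE; have [_ _ _ s'0 _] := hB.
(* Only these [p] terms of the tail can be nonzero, and [svd_minimax] needs [r + p] within the
   matrix dimensions. *)
pose p := minn r (minn n m - r).
have rp : (r + p <= minn n m)%N by rewrite /p; lia.
have pr : (p <= r)%N by exact: geq_minl.
have [F [hF GF Fs]] := svd_minimax (lead_cols r V) rp hB.
have bF := op_bounded_frame hF.
have -> : tail_frob r s' = Num.sqrt (\sum_(j < p) s' (r + j)%N ^+ 2).
  rewrite /tail_frob -!(big_mkord xpredT (fun j => s' (r + j)%N ^+ 2)).
  rewrite (big_cat_nat (leq0n p) pr) //=.
  rewrite [X in _ + X]big_nat_cond [X in _ + X]big1 ?addr0 // => j.
  by rewrite andbT /p => jp; rewrite s'0 ?expr0n //; lia.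
apply: le_trans (_ : frob ((A + E) *m F) <= _).
  apply: le_trans (ler_wsqrtr Fs) _; by rewrite sqrtr_sqr ger0_norm ?frob_ge0.
rewrite mulmxDl; apply: le_trans (frobD _ _) (lerD _ _); last first.
  by rewrite -[leRHS]mul1r; exact: (svd_hard_thr_frob_le rnm hE bF pr).
have -> : A *m F = A *m coproj (lead_cols r V) *m F.
  by rewrite -mulmxA /coproj mulmxBl mul1mx -mulmxA GF mulmx0 subr0.
by rewrite -[leRHS]mul1r; exact: (svd_coproj_frob_le rnm hA bF pr).
Qed.

End Truncation.

(** * Perturbation of the embeddings *)

Section Perturbation.
Variable R : realType.

Lemma frob_mulmxr_le n m k (A : 'M[R]_(n, m)) (B : 'M[R]_(m, k)) c :
  op_bounded B c -> frob (A *m B) <= c * frob A.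
Proof.
move=> /op_bounded_trmx [_ hB].
by rewrite -frob_trmx trmx_mul -(frob_trmx A).
Qed.

(* In the coordinates [K = P^T P'] and [L = F^T F'] this is the entrywise bound
   [(d - d')^2 K^2 <= (d L - d' K)^2 + (d K - d' L)^2]. *)
Lemma polar_frob_le r m (P P' : 'M[R]_r) (F F' : 'M[R]_(m, r)) (d d' : 'rV[R]_r) :
  orthogonal_mx P -> orthogonal_mx P' -> frame F -> frame F' ->
  (forall i, 0 <= d 0 i) -> (forall i, 0 <= d' 0 i) ->
  frob (P *m diag_mx d *m P^T - P' *m diag_mx d' *m P'^T) ^+ 2 <=
  2 * frob (P *m diag_mx d *m F^T - P' *m diag_mx d' *m F'^T) ^+ 2.
Proof.
move=> hP hP' hF hF' d0 d'0.
set M := P *m diag_mx d *m F^T - _.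
pose K := P^T *m P'; pose L := F^T *m F'.
have eK : frob (P *m diag_mx d *m P^T - P' *m diag_mx d' *m P'^T) =
    frob (diag_mx d *m K - K *m diag_mx d').
  rewrite -(frob_frame _ (orthogonal_mx_tr hP)) -frob_trmx.
  rewrite -(frob_frame _ (orthogonal_mx_tr hP')) -frob_trmx trmx_mul !trmxK.
  congr frob; rewrite mulmxBr mulmxBl !mulmxA hP mul1mx.
  by rewrite -(mulmxA _ P'^T) hP' mulmx1.
(* This difference and the next one are compressions of [M] and [M^T] by orthonormal frames; adding
   their squares produces the factor 2. *)
have e1 : frob (diag_mx d *m L - K *m diag_mx d') <= frob M.
  have -> : diag_mx d *m L - K *m diag_mx d' = P^T *m M *m F'.
    rewrite mulmxBr mulmxBl !mulmxA hP mul1mx -!mulmxA.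
    by rewrite hF' mulmx1 !mulmxA.
  apply: le_trans (frob_mulmxr_le _ (op_bounded_frame hF')) _; rewrite mul1r.
  by rewrite frob_frame //; exact: orthogonal_mx_tr.
have e2 : frob (diag_mx d *m K - L *m diag_mx d') <= frob M.
  have -> : diag_mx d *m K - L *m diag_mx d' = F^T *m M^T *m P'.
    rewrite linearB /= !trmx_mul !trmxK !tr_diag_mx mulmxBr mulmxBl !mulmxA hF mul1mx.
    by rewrite -!mulmxA hP' mulmx1 !mulmxA.
  rewrite -(frob_trmx M).
  apply: le_trans (frob_mulmxr_le _ (op_bounded_frame hP')) _; rewrite mul1r.
  by have := proj2 (op_bounded_trmx (op_bounded_frame hF)) _ M^T; rewrite mul1r.
apply: le_trans (_ : frob (diag_mx d *m L - K *m diag_mx d') ^+ 2 +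
  frob (diag_mx d *m K - L *m diag_mx d') ^+ 2 <= _).
  rewrite eK !frob_sqr -big_split /=; clearbody K L; apply: ler_sum => i _.
  rewrite -big_split /=; apply: ler_sum => j _.
  rewrite !mul_diag_mx !mul_mx_diag !mxE.
  set k := K i j; set l := L i j; set x := d 0 i; set y := d' 0 j.
  have x0 : 0 <= x by exact: d0.
  have y0 : 0 <= y by exact: d'0.
  rewrite -subr_ge0; set D := (X in 0 <= X).
  (* Both terms are nonnegative because the diagonals [d] and [d'] are. *)
  have -> : D = (x - y) ^+ 2 * l ^+ 2 + 2 * (x * y) * (l - k) ^+ 2 by rewrite /D; ring.
  by rewrite addr_ge0 // mulr_ge0 ?sqr_ge0 // mulr_ge0 // mulr_ge0.
rewrite mulr_natl mulr2n lerD // lerXn2r ?nnegrE ?frob_ge0 //.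
Qed.

Lemma hard_thr_trmx n m r (U : 'M[R]_n) s (V : 'M[R]_m) :
  (hard_thr r U s V)^T = hard_thr r V s U.
Proof. by rewrite /hard_thr !trmx_mul trmxK diag_rect_tr mulmxA. Qed.

(** * Sine bounds between leading singular subspaces *)

Lemma op_bounded_lead_sigma_inv k r s (B : 'M[R]_(k, r)) c :
  (0 < r)%N -> (forall i j, (i <= j)%N -> s j <= s i) -> 0 < s r.-1 ->
  op_bounded (B *m lead_sigma r s) c -> op_bounded B (c / s r.-1).
Proof.
move=> r0 smono sr0 hB.
have si (i : 'I_r) : s r.-1 <= s i by apply: smono; have := ltn_ord i; lia.
have -> : B = B *m lead_sigma r s *m diag_mx (\row_(i < r) (s i)^-1).
  rewrite /lead_sigma diag_rect_diag -mulmxA mulmx_diag -[LHS]mulmx1; congr (_ *m _).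
  apply/matrixP => i j; rewrite !mxE divff //.
  by rewrite gt_eqF // (lt_le_trans sr0).
apply: op_boundedM hB _; apply: op_bounded_diag => [|i].
  by rewrite invr_ge0 ltW.
have si0 : 0 < s i by exact: lt_le_trans (si i).
by rewrite mxE ger0_norm ?invr_ge0 ?(ltW si0) // lef_pV2.
Qed.

Lemma op_bounded_coproj_frame n k l (F : 'M[R]_(n, k)) (G : 'M[R]_(n, l)) :
  frame F -> frame G -> op_bounded (coproj F *m G) 1.
Proof.
move=> hF hG; rewrite -[1]mulr1; apply: op_boundedM (op_bounded_frame hG).
exact: op_bounded_coproj.
Qed.

(** Multiplying the left sine matrix by [Sigma_1] turns it into [coproj U1' A V1]. Substituting
    [A = B - E] and moving the projection through [B] leaves the right sine matrix, damped by
    [s' r], and an error of size [e]. *)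
Lemma wedin_step n m r (A E : 'M[R]_(n, m)) U s V U' s' V' e l :
  (0 < r)%N -> (r <= minn n m)%N -> is_svd A U s V -> is_svd (A + E) U' s' V' ->
  op_bounded E e -> 0 < s r.-1 ->
  op_bounded (coproj (lead_cols r V') *m lead_cols r V) l ->
  op_bounded (coproj (lead_cols r U') *m lead_cols r U) ((s' r * l + e) / s r.-1).
Proof.
move=> r0 rnm hA hB hE sr0 hl;
have [hU hV [smono _] _ _] := hA; have [hU' hV' _ _ _] := hB.
have [rn rm] : (r <= n)%N /\ (r <= m)%N by apply/andP; rewrite -leq_min.
apply: op_bounded_lead_sigma_inv => //.
rewrite -mulmxA -(svd_lead_cols rnm hA) mulmxA.
have -> : coproj (lead_cols r U') *m A *m lead_cols r V =
    (A + E) *m coproj (lead_cols r V') *m (coproj (lead_cols r V') *m lead_cols r V) -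
    coproj (lead_cols r U') *m E *m lead_cols r V.
  rewrite mulmxA -(mulmxA (A + E)) coproj_idem; last exact: lead_cols_frame.
  by rewrite (svd_coproj_comm rnm hB) -mulmxBl -mulmxBr addrK.
apply: op_boundedB; first by apply: op_boundedM hl; exact: svd_coproj_op_bounded hB.
rewrite -[e]mulr1; apply: op_boundedM; last exact/op_bounded_frame/lead_cols_frame.
by rewrite -[e]mul1r; apply: op_boundedM hE; exact/op_bounded_coproj/lead_cols_frame.
Qed.

(** For the norms [k], [l] of the two sine matrices, [wedin_step] on [A] and on [A^T] gives
    [k s_r <= s'_(r+1) l + e] and the same with [k], [l] exchanged. The larger of the two can then
    be isolated. *)
Lemma wedin n m r (A E : 'M[R]_(n, m)) U s V U' s' V' e :
  (0 < r)%N -> (r <= minn n m)%N -> is_svd A U s V -> is_svd (A + E) U' s' V' ->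
  op_bounded E e -> s' r < s r.-1 ->
  op_bounded (coproj (lead_cols r U') *m lead_cols r U) (e / (s r.-1 - s' r)) /\
  op_bounded (coproj (lead_cols r V') *m lead_cols r V) (e / (s r.-1 - s' r)).
Proof.
move=> r0 rnm hA hB hE gap; have s'0 : 0 <= s' r by case: hB => _ _ [_ ->].
have sr0 : 0 < s r.-1 by exact: le_lt_trans gap.
set KU := coproj (lead_cols r U') *m _; set KV := coproj (lead_cols r V') *m _.
have hk := specnorm_op_bounded KU; have hl := specnorm_op_bounded KV.
have k1 := specnorm_le (wedin_step r0 rnm hA hB hE sr0 hl).
have hBT : is_svd (A^T + E^T) V' s' U' by rewrite -linearD; exact: is_svd_trmx.
have rmn : (r <= minn m n)%N by rewrite minnC.
have l1 := specnorm_le (wedin_step r0 rmn (is_svd_trmx hA) hBT (op_bounded_trmx hE) sr0 hk).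
move: k1 l1; rewrite -/KU -/KV !ler_pdivlMr // => k1 l1.
have g0 : 0 < s r.-1 - s' r by rewrite subr_gt0.
have k0 := specnorm_ge0 KU; have l0 := specnorm_ge0 KV.
have [kb lb] : specnorm KU <= e / (s r.-1 - s' r) /\ specnorm KV <= e / (s r.-1 - s' r).
  rewrite !ler_pdivlMr //; case: (leP (specnorm KU) (specnorm KV)) => kl; split.
  - have : specnorm KU * (s r.-1 - s' r) <= specnorm KV * (s r.-1 - s' r).
      by rewrite ler_pM2r.
    have := ler_wpM2l s'0 kl; lra.
  - have := ler_wpM2l s'0 kl; lra.
  - have := ler_wpM2l s'0 (ltW kl); lra.
  - have : specnorm KV * (s r.-1 - s' r) <= specnorm KU * (s r.-1 - s' r).
      by rewrite ler_pM2r // ltW.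
    have := ler_wpM2l s'0 (ltW kl); lra.
by split; [exact: op_bounded_le hk kb|exact: op_bounded_le hl lb].
Qed.

Lemma mu_coef_le1 (e x y : R) : mu_coef e x y <= 1.
Proof. by rewrite /mu_coef; case: ifP => // _; rewrite ge_min lexx orbT. Qed.

Lemma mu_coef_ge0 (e x y : R) : 0 <= e -> y <= x -> 0 <= mu_coef e x y.
Proof.
move=> e0 yx; rewrite /mu_coef; case: ifP => // _.
by rewrite le_min ler01 andbT divr_ge0 ?mulr_ge0 // subr_ge0.
Qed.

(* By Weyl's inequality the mixed gaps [s r.-1 - s' r] and [s' r.-1 - s r] are at
   least [s r.-1 - s r - ||E||], so half the gap of [A] when [2 ||E||] is smaller. *)
Lemma op_bounded_sin_theta n m r (A E : 'M[R]_(n, m)) U s V U' s' V' :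
  (0 < r)%N -> (r <= minn n m)%N -> is_svd A U s V -> is_svd (A + E) U' s' V' ->
  let mu := mu_coef (specnorm E) (s r.-1) (s r) in
  [/\ op_bounded (coproj (lead_cols r V') *m lead_cols r V) mu,
      op_bounded (coproj (lead_cols r U) *m lead_cols r U') mu &
      op_bounded (coproj (lead_cols r V) *m lead_cols r V') mu].
Proof.
move=> r0 rnm hA hB mu.
have hE := specnorm_op_bounded E; have [e0 _] := hE.
have [hU hV [smono _] _ _] := hA; have [hU' hV' _ _ _] := hB.
have [rn rm] : (r <= n)%N /\ (r <= m)%N by apply/andP; rewrite -leq_min.
have triv : [/\ op_bounded (coproj (lead_cols r V') *m lead_cols r V) 1,
      op_bounded (coproj (lead_cols r U) *m lead_cols r U') 1 &
      op_bounded (coproj (lead_cols r V) *m lead_cols r V') 1].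
  by split; apply: op_bounded_coproj_frame; exact: lead_cols_frame.
rewrite /mu /mu_coef; case: eqVneq => // sne.
set e := specnorm E in hE e0 *; set g := s r.-1 - s r.
have g0 : 0 < g by rewrite subr_gt0 lt_neqAle eq_sym sne smono // leq_pred.
case: leP => // eg.
have eg' : 2 * e <= g by rewrite ler_pdivrMr // mul1r in eg.
(* Viewing [A] as a perturbation of [A + E] by [- E] yields the sines in the opposite direction. *)
have hA' : is_svd ((A + E) + - E) U s V by rewrite addrK.
have w1 := svd_weyl r hA hB hE.
have w2 := svd_weyl r.-1 hB hA' (op_boundedN hE).
have gE : g = s r.-1 - s r by [].
have half x : g - e <= x -> e / x <= 2 * e / g.
  move=> gx; have x0 : 0 < x by lra.
  rewrite ler_pdivrMr // mulrAC ler_pdivlMr //.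
  by have := ler_wpM2l e0 (_ : g <= 2 * x); rewrite mulrCA mulrA; apply; lra.
have [|_ h1] := wedin r0 rnm hA hB hE; first by lra.
have [|h2 h3] := wedin r0 rnm hB hA' (op_boundedN hE); first by lra.
split; [apply: op_bounded_le h1 _|apply: op_bounded_le h2 _|apply: op_bounded_le h3 _];
  apply: half; lra.
Qed.

(** * Orthogonal alignment of the two embeddings *)

Section Embeddings.
Variables (n m r : nat) (A E : 'M[R]_(n, m)).
Variables (U : 'M[R]_n) (s : nat -> R) (V : 'M[R]_m).
Variables (U' : 'M[R]_n) (s' : nat -> R) (V' : 'M[R]_m).
Hypotheses (r0 : (0 < r)%N) (rnm : (r <= minn n m)%N).
Hypotheses (hA : is_svd A U s V) (hB : is_svd (A + E) U' s' V').

Let mu := mu_coef (specnorm E) (s r.-1) (s r).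
Let X := lead_cols r U *m lead_sigma r s.
Let X' := lead_cols r U' *m lead_sigma r s'.

Let rn : (r <= n)%N. Proof. by move: rnm; rewrite leq_min => /andP[]. Qed.
Let rm : (r <= m)%N. Proof. by move: rnm; rewrite leq_min => /andP[]. Qed.
Let fU : frame (lead_cols r U).
Proof. by case: hA => ? ? _ _ _; exact: lead_cols_frame. Qed.
Let fV : frame (lead_cols r V).
Proof. by case: hA => ? ? _ _ _; exact: lead_cols_frame. Qed.
Let fU' : frame (lead_cols r U').
Proof. by case: hB => ? ? _ _ _; exact: lead_cols_frame. Qed.
Let fV' : frame (lead_cols r V').
Proof. by case: hB => ? ? _ _ _; exact: lead_cols_frame. Qed.

Let mu0 : 0 <= mu.
Proof.
apply: mu_coef_ge0; rewrite ?specnorm_ge0 //.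
by case: hA => _ _ [-> //]; rewrite leq_pred.
Qed.
Let mu1 : mu <= 1. Proof. exact: mu_coef_le1. Qed.

Let lead_trmul : (lead_cols r U')^T *m (A + E) = lead_sigma r s' *m (lead_cols r V')^T.
Proof.
have rmn : (r <= minn m n)%N by rewrite minnC.
have := congr1 trmx (svd_lead_cols rmn (is_svd_trmx hB)).
by rewrite !trmx_mul trmxK /lead_sigma diag_rect_tr.
Qed.

(** The tail of [A] has range orthogonal to [U1], so a projection can be inserted; this brings in
    the left sine and thus a factor [mu]. *)
Let lead_coproj : (lead_cols r U')^T *m (A *m coproj (lead_cols r V)) =
  (coproj (lead_cols r U) *m lead_cols r U')^T *m (A *m coproj (lead_cols r V)).
Proof.
rewrite trmx_mul coproj_tr (svd_coproj_comm rnm hA) -!mulmxA.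
by rewrite (mulmxA (coproj _) (coproj _)) coproj_idem.
Qed.

Lemma specnorm_alignment : exists2 Q : 'M[R]_r, orthogonal_mx Q &
  specnorm (X - X' *m Q) <= 3 * specnorm E + 3 * s r * mu.
Proof.
have hE := specnorm_op_bounded E; have e0 := proj1 hE.
have [hV'V hUU' _] := op_bounded_sin_theta r0 rnm hA hB; rewrite -/mu in hV'V hUU'.
have [P [O [d [hP hO d0 hW]]]] :=
  singular_value_decomposition ((lead_cols r V')^T *m lead_cols r V).
have hPT := orthogonal_mx_tr hP; have hOT := orthogonal_mx_tr hO.
pose Q := O *m P^T.
have hQ : orthogonal_mx Q by exact: orthogonal_mxM.
have hQT := orthogonal_mx_tr hQ.
(* [Q] rotates [X] onto [X']; the goal rotates [X'], and the norm is invariant under the inverse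
   rotation. *)
exists Q^T => //; apply: specnorm_le.
have -> : X - X' *m Q^T = - ((X' - X *m Q) *m Q^T).
  by rewrite mulmxBl -(mulmxA X) (mulmx1C hQ) mulmx1 opprB.
apply: op_boundedN; rewrite -[3 * _ + _]mulr1; apply: op_boundedM (op_bounded_frame hQT).
pose H := P *m diag_mx d *m P^T.
have eH : (lead_cols r V')^T *m lead_cols r V *m Q = H.
  by rewrite hW /Q mulmxA -(mulmxA _ O^T) hO mulmx1.
clearbody Q.
(* [J] is [(1 + H)^-1], of norm at most 1 since [d >= 0]. *)
pose J := P *m diag_mx (\row_i (1 + d 0 i)^-1) *m P^T.
have hJ : op_bounded J 1.
  rewrite -[1]mulr1 -[1 * 1]mulr1; apply: op_boundedM (op_bounded_frame hPT).
  rewrite -[1 * 1]mulr1 mul1r; apply: op_boundedM (op_bounded_frame hP) _.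
  apply: op_bounded_diag => // i; have di := d0 i; have d1 : 0 < 1 + d 0 i by lra.
  by rewrite mxE ger0_norm ?invr_ge0 ?(ltW d1) // invf_le1 //; lra.
have HHT : H *m H^T =
    (lead_cols r V')^T *m (lead_cols r V *m (lead_cols r V)^T) *m lead_cols r V'.
  rewrite -eH !trmx_mul trmxK !mulmxA -(mulmxA _ Q) (mulmx1C hQ) mulmx1.
  by rewrite -!mulmxA.
have e1H : 1%:M - H = (lead_cols r V')^T *m coproj (lead_cols r V) *m lead_cols r V' *m J.
  have -> : (lead_cols r V')^T *m coproj (lead_cols r V) *m lead_cols r V' = 1%:M - H *m H^T.
    by rewrite HHT /coproj mulmxBr mulmx1 mulmxBl fV'.
  have -> : H *m H^T = P *m diag_mx (\row_i (d 0 i) ^+ 2) *m P^T.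
    rewrite /H !trmx_mul trmxK tr_diag_mx !mulmxA -(mulmxA _ P^T) hP mulmx1.
    by rewrite -(mulmxA P) mulmx_diag; congr (_ *m diag_mx _ *m _).
  rewrite mulmxBl mul1mx /J !mulmxA -(mulmxA _ P^T) hP mulmx1.
  rewrite -[P *m diag_mx _ *m diag_mx _]mulmxA mulmx_diag.
  rewrite -{1}(mulmx1C hP) -{1}(mulmx1 P) -mulmxBl -mulmxBr -mulmxBl -mulmxBr.
  congr (_ *m _ *m _); apply/matrixP => i j; rewrite !mxE.
  have [->|_] := eqVneq i j; rewrite ?mulr1n ?mulr0n ?subrr //.
  by field; rewrite gt_eqF // ltr_wpDr.
clearbody H J.
(* Since [S1' V1'^T = U1'^T B], the large singular values meet [coproj V1]: only the tail of [A], of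
   norm [s r] and damped by a sine, and [E] survive. *)
have eS1H : lead_sigma r s' *m (1%:M - H) = ((coproj (lead_cols r U) *m lead_cols r U')^T *m
    (A *m coproj (lead_cols r V)) + (lead_cols r U')^T *m E *m coproj (lead_cols r V)) *m
    lead_cols r V' *m J.
  rewrite e1H !mulmxA -lead_trmul; congr (_ *m _ *m _).
  by rewrite (mulmxDr (lead_cols r U')^T) (mulmxDl (_^T *m A))
    -(mulmxA (lead_cols r U')^T A) lead_coproj mulmxA.
have -> : X' - X *m Q = lead_cols r U' *m (lead_sigma r s' *m (1%:M - H)) -
    (A + E) *m coproj (lead_cols r V') *m (coproj (lead_cols r V') *m lead_cols r V) *m Q +
    E *m lead_cols r V *m Q.
  rewrite /X /X' -(svd_lead_cols rnm hA) [in RHS]mulmxA -(svd_lead_cols rnm hB).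
  have dec : (A + E) *m lead_cols r V *m Q = (A + E) *m lead_cols r V' *m H +
      (A + E) *m coproj (lead_cols r V') *m (coproj (lead_cols r V') *m lead_cols r V) *m Q.
    have eB : A + E = (A + E) *m lead_cols r V' *m (lead_cols r V')^T +
        (A + E) *m coproj (lead_cols r V').
      by rewrite /coproj mulmxBr mulmx1 mulmxA [in RHS]addrC subrK.
    rewrite {1}eB (mulmxDl (_ *m _)) (mulmxDl (_ *m _)); congr (_ + _).
      by rewrite -eH -!mulmxA.
    by rewrite [in RHS]mulmxA -[in RHS](mulmxA (A + E)) coproj_idem.
  have -> : A *m lead_cols r V *m Q = (A + E) *m lead_cols r V *m Q - E *m lead_cols r V *m Q.
    by rewrite !mulmxDl addrK.
  by rewrite dec (mulmxBr (_ *m lead_cols r V') 1%:M H) mulmx1 opprD opprK opprD !addrA.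
have sr0 : 0 <= s r by case: hA => _ _ [_ ->].
have bE : op_bounded ((lead_cols r U')^T *m E *m coproj (lead_cols r V)) (1 * specnorm E * 1).
  apply: op_boundedM; last exact: op_bounded_coproj.
  by apply: op_boundedM hE; apply: op_bounded_trmx; exact: op_bounded_frame.
have bA : op_bounded ((coproj (lead_cols r U) *m lead_cols r U')^T *m
    (A *m coproj (lead_cols r V))) (mu * s r).
  by apply: op_boundedM (svd_coproj_op_bounded rnm hA); exact: op_bounded_trmx.
have b1 : op_bounded (lead_cols r U' *m (lead_sigma r s' *m (1%:M - H)))
    (1 * ((mu * s r + 1 * specnorm E * 1) * 1 * 1)).
  apply: op_boundedM; first exact: op_bounded_frame.
  rewrite eS1H; apply: op_boundedM hJ; apply: op_boundedM (op_bounded_frame fV').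
  exact: op_boundedD.
have b2 : op_bounded ((A + E) *m coproj (lead_cols r V') *m
    (coproj (lead_cols r V') *m lead_cols r V) *m Q) (s' r * mu * 1).
  apply: op_boundedM (op_bounded_frame hQ); apply: op_boundedM hV'V.
  exact: svd_coproj_op_bounded hB.
have b3 : op_bounded (E *m lead_cols r V *m Q) (specnorm E * 1 * 1).
  by apply: op_boundedM (op_bounded_frame hQ); apply: op_boundedM (op_bounded_frame fV).
(* The three bounds add up to [mu * s r + s' r * mu + 2 ||E||]; Weyl's inequality and [mu <= 1]
   bring this to at most [3 ||E|| + 2 * s r * mu]. *)
apply: op_bounded_le (op_boundedD (op_boundedB b1 b2) b3) _.
have := ler_wpM2r mu0 (svd_weyl r hA hB hE).
have := ler_wpM2l e0 mu1; have := mulr_ge0 sr0 mu0; lra.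
Qed.

Lemma frob_alignment Ue se Ve : is_svd E Ue se Ve ->
  let a := frob (hard_thr r Ue se Ve) in
  let b := tail_frob r s in
  exists2 Q : 'M[R]_r, orthogonal_mx Q &
  frob (X - X' *m Q) <= Num.sqrt (2 * a ^+ 2 + 3 * (a + b * mu) ^+ 2) + a + b * mu.
Proof.
move=> hE a b.
have [hV'V hUU' _] := op_bounded_sin_theta r0 rnm hA hB; rewrite -/mu in hV'V hUU'.
have a0 : 0 <= a by exact: frob_ge0.
have b0 : 0 <= b by exact: sqrtr_ge0.
have rmn : (r <= minn m n)%N by rewrite minnC.
have [P [O [d [hP hO d0 hW]]]] := singular_value_decomposition ((lead_cols r U')^T *m X).
have hPT := orthogonal_mx_tr hP; have hOT := orthogonal_mx_tr hO.
pose Q := O *m P^T.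
have hQ : orthogonal_mx Q by exact: orthogonal_mxM.
have hQT := orthogonal_mx_tr hQ.
have eQ : (lead_cols r U')^T *m X *m Q = P *m diag_mx d *m P^T.
  by rewrite hW /Q mulmxA -(mulmxA _ O^T) hO mulmx1.
clearbody Q; exists Q^T => //.
have -> : frob (X - X' *m Q^T) = frob (X' - X *m Q).
  have -> : X - X' *m Q^T = - ((X' - X *m Q) *m Q^T).
    by rewrite mulmxBl -(mulmxA X) (mulmx1C hQ) mulmx1 opprB.
  by rewrite frobN -frob_trmx trmx_mul trmxK (frob_frame _ hQ) frob_trmx.
have EV : frob (E *m lead_cols r V) <= a.
  by rewrite -[leRHS]mul1r; exact: (svd_hard_thr_frob_le rnm hE (op_bounded_frame fV) (leqnn r)).
have UE : frob ((lead_cols r U')^T *m E) <= a.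
  rewrite -frob_trmx trmx_mul trmxK -[leRHS]mul1r /a.
  rewrite -(frob_trmx (hard_thr _ _ _ _)) hard_thr_trmx.
  exact: (svd_hard_thr_frob_le rmn (is_svd_trmx hE) (op_bounded_frame fU') (leqnn r)).
have UTle k (B : 'M[R]_(n, k)) : frob ((lead_cols r U')^T *m B) <= frob B.
  rewrite -[leRHS]mul1r; exact: (proj2 (op_bounded_trmx (op_bounded_frame fU'))).
have cUle k (B : 'M[R]_(n, k)) : frob (coproj (lead_cols r U') *m B) <= frob B.
  rewrite -[leRHS]mul1r; exact: (proj2 (op_bounded_coproj fU')).
(* Both terms of [N] are in polar form: the first is [S1' V1'^T], the second [P diag(d) (V1 O)^T],
   with positive factors [S1'] and [H]. [N] is estimated separately on the range of [V1] and on its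
   complement. *)
pose N := (lead_cols r U')^T *m (A + E) -
  (lead_cols r U')^T *m A *m lead_cols r V *m (lead_cols r V)^T.
have NV : frob (N *m lead_cols r V) <= a.
  rewrite /N mulmxBl -[X in _ - X]mulmxA fV mulmx1 mulmxDr mulmxDl addrC addKr.
  by rewrite -mulmxA; apply: le_trans (UTle _ _) _.
have Nc : frob (N *m coproj (lead_cols r V)) <= a + b * mu.
  have -> : N *m coproj (lead_cols r V) = (lead_cols r U')^T *m E *m coproj (lead_cols r V) +
      (coproj (lead_cols r U) *m lead_cols r U')^T *m (A *m coproj (lead_cols r V)).
    rewrite /N mulmxBl -[X in _ - X]mulmxA.
    have -> : (lead_cols r V)^T *m coproj (lead_cols r V) = 0.
      by rewrite -coproj_tr -trmx_mul coproj_frame // trmx0.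
    by rewrite mulmx0 subr0 (mulmxDr (lead_cols r U')^T) (mulmxDl (_^T *m A))
      -(mulmxA (lead_cols r U')^T A) lead_coproj addrC.
  apply: le_trans (frobD _ _) (lerD _ _).
    apply: le_trans (frob_mulmxr_le _ (op_bounded_coproj fV)) _.
    by rewrite mul1r.
  rewrite -frob_trmx trmx_mul trmxK trmx_mul coproj_tr -(svd_coproj_comm rmn (is_svd_trmx hA)).
  by rewrite mulrC; exact: (svd_coproj_frob_le rmn (is_svd_trmx hA) hUU' (leqnn r)).
have N2 : frob N ^+ 2 <= a ^+ 2 + (a + b * mu) ^+ 2.
  rewrite -(frob_trmx N) (frob_pythagoras _ fV) -trmx_mul frob_trmx.
  rewrite -coproj_tr -trmx_mul frob_trmx.
  by rewrite lerD // lerXn2r ?nnegrE ?frob_ge0 // addr_ge0 ?mulr_ge0.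
have par : frob ((lead_cols r U')^T *m (X' - X *m Q)) ^+ 2 <=
    2 * (a ^+ 2 + (a + b * mu) ^+ 2).
  have -> : (lead_cols r U')^T *m (X' - X *m Q) =
      1%:M *m diag_mx (\row_i s' i) *m 1%:M^T - P *m diag_mx d *m P^T.
    rewrite mulmxBr /X' mulmxA fU' mul1mx trmx1 mulmx1 mul1mx /lead_sigma diag_rect_diag.
    by rewrite mulmxA eQ.
  have o1 : orthogonal_mx (1%:M : 'M[R]_r) by rewrite /orthogonal_mx trmx1 mulmx1.
  have fVO : frame (lead_cols r V *m O).
    by rewrite /frame trmx_mul mulmxA -(mulmxA _ _ (lead_cols r V)) fV mulmx1.
  apply: le_trans (polar_frob_le o1 hP fV' fVO _ d0) _.
    by move=> i; rewrite mxE; case: hB => _ _ [_ ->].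
  rewrite ler_pM2l //; apply: le_trans N2.
  rewrite (_ : _ - _ = N) //; rewrite mul1mx -diag_rect_diag -/(lead_sigma r s') -lead_trmul /N.
  by rewrite trmx_mul mulmxA -hW /X -(svd_lead_cols rnm hA) !mulmxA.
(* [coproj U1'] kills [X']. The rest is handled as in [wedin_step], with the tail of [B] in place of
   its norm: the bound is [mu (a + b) + a], at most [2 (a + b mu)] as [mu <= 1]. *)
have perp : frob (coproj (lead_cols r U') *m (X' - X *m Q)) <= 2 * (a + b * mu).
  have -> : coproj (lead_cols r U') *m (X' - X *m Q) =
      - ((A + E) *m coproj (lead_cols r V') *m (coproj (lead_cols r V') *m lead_cols r V) -
      coproj (lead_cols r U') *m (E *m lead_cols r V)) *m Q.
    have -> : (A + E) *m coproj (lead_cols r V') *m (coproj (lead_cols r V') *m lead_cols r V) =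
        coproj (lead_cols r U') *m ((A + E) *m lead_cols r V).
      by rewrite mulmxA -(mulmxA (A + E)) coproj_idem // (svd_coproj_comm rnm hB) -mulmxA.
    rewrite -mulmxBr -mulmxBl addrK (svd_lead_cols rnm hA) -/X mulmxBr /X'.
    by rewrite (mulmxA _ _ (lead_sigma r s')) coproj_frame // mul0mx sub0r mulNmx mulmxA.
  apply: le_trans (frob_mulmxr_le _ (op_bounded_frame hQ)) _; rewrite mul1r frobN.
  apply: le_trans (frobB _ _) _.
  have h1 := svd_coproj_frob_le rnm hB hV'V (leqnn r).
  have h2 := ler_wpM2l mu0 (tail_frob_perturbation rnm hA hB hE).
  have h3 := le_trans (cUle _ (E *m lead_cols r V)) EV.
  have h4 := ler_wpM2l a0 mu1; have h5 := mulr_ge0 b0 mu0.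
  rewrite -/a -/b in h2; lra.
set c := a + b * mu in N2 Nc par perp *.
have c0 : 0 <= c by rewrite addr_ge0 ?mulr_ge0.
rewrite -addrA -/c; set D := 2 * a ^+ 2 + 3 * c ^+ 2.
have D0 : 0 <= D by rewrite addr_ge0 // mulr_ge0 ?sqr_ge0.
(* The two squared parts sum to at most [2 a^2 + 2 c^2 + 4 c^2 = D + 3 c^2], which is below
   [(sqrt D + c)^2] once [c <= sqrt D]. *)
have cD : c <= Num.sqrt D.
  rewrite -(ger0_norm c0) -sqrtr_sqr ler_wsqrtr // /D.
  by have := sqr_ge0 a; have := sqr_ge0 c; lra.
apply: frob_le_bound; first by rewrite addr_ge0 ?sqrtr_ge0.
rewrite (frob_pythagoras _ fU').
have p2 : frob (coproj (lead_cols r U') *m (X' - X *m Q)) ^+ 2 <= (2 * c) ^+ 2.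
  by rewrite lerXn2r ?nnegrE ?frob_ge0 // mulr_ge0.
have := ler_wpM2r c0 cD; have := sqr_sqrtr D0; rewrite {2}/D; lra.
Qed.

End Embeddings.
End Perturbation.

Theorem theorem3p19 (R : realType) (n m r : nat)
  (A E : 'M[R]_(n, m))
  (U : 'M[R]_n) (s : nat -> R) (V : 'M[R]_m)
  (Ut : 'M[R]_n) (st : nat -> R) (Vt : 'M[R]_m)
  (Ue : 'M[R]_n) (se : nat -> R) (Ve : 'M[R]_m) :
  (1 <= r)%N -> (r < minn n m)%N ->
  is_svd A U s V ->
  is_svd (A + E) Ut st Vt ->
  is_svd E Ue se Ve ->
  let mu := mu_coef (specnorm E) (s r.-1) (s r) in
  let X := lead_cols r U *m lead_sigma r s in
  let Xt := lead_cols r Ut *m lead_sigma r st in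
  let a := frob (hard_thr r Ue se Ve) in
  let b := tail_frob r s in
  inf [set specnorm (X - Xt *m Q) | Q in [set Q : 'M[R]_r | orthogonal_mx Q]]
    <= 3 * specnorm E + 3 * s r * mu
  /\
  inf [set frob (X - Xt *m Q) | Q in [set Q : 'M[R]_r | orthogonal_mx Q]]
    <= Num.sqrt (2 * a ^+ 2 + 3 * (a + b * mu) ^+ 2) + a + b * mu.
Proof.
move=> r0 rnm hA hB hE mu X Xt a b; have rnm' := ltnW rnm.
split.
  have [Q hQ le_Q] := specnorm_alignment r0 rnm' hA hB.
  (* The infimum lies below the value at [Q] because the set of norms is bounded below by 0. *)
  apply: le_trans le_Q; apply: ge_inf; last by exists Q.
  by exists 0 => _ [O _ <-]; exact: specnorm_ge0.
have [Q hQ le_Q] := frob_alignment r0 rnm' hA hB hE.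
apply: le_trans le_Q; apply: ge_inf; last by exists Q.
by exists 0 => _ [O _ <-]; exact: frob_ge0.
Qed.
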